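(* There is a universal constant $C>0$ such that the following holds. Let $\mathcal{X}\subseteq\mathbb{R}^d$ be a nonempty closed convex set of diameter at most $R>0$, let $F:\mathcal X\to\mathbb R$ be $\gamma$-strongly-convex ($\gamma>0$), and let $\lambda\ge\gamma$, $\epsilon>0$. Then, for suitable choices of its iteration number $T$ and epoch number $K$, restarted RECAPP (given in the context) finds $x\in\mathcal X$ with $$\mathbb E F(x)-\min_{x'\in\mathcal X}F(x')\le\epsilon,$$ using one call to $\mathrm{WarmStart}_{F,\lambda}$ and at most $C\sqrt{\lambda/\gamma}\,\max\{1,\log(\lambda R^2/\epsilon)\}$ calls to each of $\mathrm{ApproxProx}_{F,\lambda}$ and $\mathrm{UnbiasedProx}_{F,\lambda}$. Moreover, if every call to $\mathrm{UnbiasedProx}_{F,\lambda}$ is implemented by the procedure MLMC (given in the context) with $p=1/2$ and $j_0=2$, then the expected total number of calls to $\mathrm{ApproxProx}_{F,\lambda}$ is at most $C\sqrt{\lambda/\gamma}\,\max\{1,\log(\lambda R^2/\epsilon)\}$.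
   Context: $\|\cdot\|$ is the Euclidean norm; $\mathrm{Proj}_{\mathcal X}$ is Euclidean projection onto $\mathcal X$. $F$ is differentiable at the points of $\mathcal X$; it is $\gamma$-strongly-convex if $F(x')\ge F(x)+\langle\nabla F(x),x'-x\rangle+\frac\gamma2\|x'-x\|^2$ for all $x,x'\in\mathcal X$. For $s\in\mathcal X$, $F^\lambda_s(x):=F(x)+\frac{\lambda}{2}\|x-s\|^2$ and $\mathrm{prox}_{F,\lambda}(s):=\arg\min_{x\in\mathcal X}F^\lambda_s(x)$. Bregman divergences: $V^F_x(x'):=F(x')-F(x)-\langle\nabla F(x),x'-x\rangle$ and $V^{\mathrm e}_x(x'):=\frac12\|x'-x\|^2$. Oracles (possibly randomized; each call uses fresh independent randomness, so its guarantee holds conditionally on its inputs and the past). Write $x^\star=\mathrm{prox}_{F,\lambda}(s)$. - $\mathrm{ApproxProx}_{F,\lambda}(s;x_{\rm init},x_{\rm prev})$, for $s,x_{\rm init},x_{\rm prev}\in\mathcal X$, returns $x\in\mathcal X$ with $\mathbb E F^\lambda_s(x)-F^\lambda_s(x^\star)\le\frac18\left(\lambda V^{\mathrm e}_{x^\star}(x_{\rm init})+V^F_{x^\star}(x_{\rm prev})\right)$. - $\mathrm{UnbiasedProx}_{F,\lambda}(s;x_{\rm prev})$, for $s,x_{\rm prev}\in\mathcal X$, returns $x\in\mathbb R^d$ with $\mathbb E x=x^\star$ and $\mathbb E\|x-x^\star\|^2\le\frac{1}{4\lambda}\left(\lambda V^{\mathrm e}_{x^\star}(s)+V^F_{x^\star}(x_{\rm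 prev})\right)$. - $\mathrm{WarmStart}_{F,\lambda}(R^2)$ returns $x_0\in\mathcal X$ with $\mathbb E F(x_0)-\min_{x'\in\mathcal X}F(x')\le\lambda R^2$. RECAPP from $x_0=v_0$ (parameters $\lambda$, $T$): set $\alpha_0=1$. For $t=0,\dots,T-1$: let $\alpha_{t+1}\in[0,1]$ satisfy $\frac{1}{\alpha_{t+1}^2}-\frac1{\alpha_{t+1}}=\frac1{\alpha_t^2}$; $s_t=(1-\alpha_{t+1})x_t+\alpha_{t+1}v_t$; $x_{t+1}=\mathrm{ApproxProx}_{F,\lambda}(s_t;s_t,x_t)$; $\tilde x_{t+1}=\mathrm{UnbiasedProx}_{F,\lambda}(s_t;x_t)$; $v_{t+1}=\mathrm{Proj}_{\mathcal X}\left(v_t-\frac1{\alpha_{t+1}}(s_t-\tilde x_{t+1})\right)$. Return $x_T$. Restarted RECAPP (parameters $\lambda,T,K$): $x^{(0)}=\mathrm{WarmStart}_{F,\lambda}(R^2)$; for $k=0,\dots,K-1$ let $x^{(k+1)}$ be the output of RECAPP run for $T$ iterations from $x_0=v_0=x^{(k)}$ (no warm start); return $x^{(K)}$. MLMC (input $s,x_{\rm prev}\in\mathcal X$; parameters $p\in[0,1)$, integer $j_0\ge0$): $x^{(0)}=\mathrm{ApproxProx}_{F,\lambda}(s;s,x_{\rm prev})$; sample $J_+\in\{0,1,2,\dots\}$ independently with $\mathbb P[J_+=k]=(1-p)p^k$; $J=j_0+J_+$; for $j=0,\dots,J-1$ set $x^{(j+1)}=\mathrm{ApproxProx}_{F,\lambda}(s;x^{(j)},x^{(j)})$;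 $p_J=(1-p)p^{J_+}$; return $x^{(j_0)}+p_J^{-1}\left(x^{(J)}-x^{(\max\{J-1,j_0\})}\right)$. *)

(* Defs.v *)
From HB Require Import structures.
From mathcomp Require Import all_boot all_order all_algebra.
From mathcomp Require Import all_classical all_reals all_analysis.
Import Order.TTheory GRing.Theory Num.Theory.
Import numFieldNormedType.Exports.

Set Implicit Arguments.
Unset Strict Implicit.
Unset Printing Implicit Defensive.

Local Open Scope classical_set_scope.
Local Open Scope ring_scope.

Section Geometry.
Context {R : realType} {d : nat}.
Local Notation V := 'rV[R]_d.
Implicit Types (X : set V) (x y s : V).

Definition dot x y : R := \sum_(i < d) x 0 i * y 0 i.

(* The library norm on row vectors is the sup norm. *)
Definition enorm x : R := Num.sqrt (dot x x).

Definition diameter_le X (r : R) : Prop :=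
  forall x y, X x -> X y -> enorm (x - y) <= r.

Definition is_argmin X (f : V -> R) x : Prop :=
  X x /\ forall y, X y -> f x <= f y.

(* Arbitrary if [f] has no minimizer on [X]. *)
Definition argmin X (f : V -> R) : V := get [set x | is_argmin X f x].

Definition Proj X y : V := argmin X (fun x => enorm (x - y)).

(* [F] stands for a function on [X] only, so differentiability at a (boundary)
   point of [X] is taken along points of [X]; a function differentiable at [x]
   in the ambient space satisfies this with its usual gradient.  If [X] has
   empty interior [gradF x] is not unique, but for [X] convex
   [dot (gradF x) (y - x)] is, for all [x] and [y] in [X]. *)
Definition is_gradient_on X (F : V -> R) (gradF : V -> V) : Prop :=
  forall x, X x -> forall e : R, 0 < e ->
    \forall y \near within X (nbhs x),
      `|F y - F x - dot (gradF x) (y - x)| <= e * enorm (y - x).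

Definition strongly_convex_on X (F : V -> R) (gradF : V -> V) (gam : R) : Prop :=
  forall x x', X x -> X x' ->
    F x + dot (gradF x) (x' - x) + gam / 2 * enorm (x' - x) ^+ 2 <= F x'.

Definition regularized (F : V -> R) (lam : R) s x : R :=
  F x + lam / 2 * enorm (x - s) ^+ 2.

Definition prox X (F : V -> R) (lam : R) s : V := argmin X (regularized F lam s).

Definition bregman (F : V -> R) (gradF : V -> V) x x' : R :=
  F x' - F x - dot (gradF x) (x' - x).

Definition bregman_e x x' : R := 2^-1 * enorm (x' - x) ^+ 2.

End Geometry.

(* Randomized algorithms with oracle access: a well-founded tree whose nodes
   are oracle calls or geometric samples and whose leaves are outputs. *)
Inductive prog (R V A : Type) : Type :=
| Ret of A
| ApproxProx of V & V & V & (V -> prog R V A)   (* s, x_init, x_prev *)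
| UnbiasedProx of V & V & (V -> prog R V A)     (* s, x_prev *)
| WarmStart of R & (V -> prog R V A)            (* R^2 *)
| Geometric of R & (nat -> prog R V A).         (* p *)
Arguments Ret {R V A}.
Arguments ApproxProx {R V A}.
Arguments UnbiasedProx {R V A}.
Arguments WarmStart {R V A}.
Arguments Geometric {R V A}.

Section Programs.
Context {R V : Type}.

Fixpoint bind {A B : Type} (q : prog R V A) (h : A -> prog R V B) : prog R V B :=
  match q with
  | Ret a => h a
  | ApproxProx s xi xp k => ApproxProx s xi xp (fun y => bind (k y) h)
  | UnbiasedProx s xp k => UnbiasedProx s xp (fun y => bind (k y) h)
  | WarmStart r2 k => WarmStart r2 (fun y => bind (k y) h)
  | Geometric p k => Geometric p (fun n => bind (k n) h)
  end.

(* Replaces every call to UnbiasedProx by a run of [impl]. *)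
Fixpoint implement_unbiased {A : Type} (impl : V -> V -> prog R V V)
    (q : prog R V A) : prog R V A :=
  match q with
  | Ret a => Ret a
  | ApproxProx s xi xp k =>
      ApproxProx s xi xp (fun y => implement_unbiased impl (k y))
  | UnbiasedProx s xp k =>
      bind (impl s xp) (fun y => implement_unbiased impl (k y))
  | WarmStart r2 k => WarmStart r2 (fun y => implement_unbiased impl (k y))
  | Geometric p k => Geometric p (fun n => implement_unbiased impl (k n))
  end.

Record calls : Type := Calls { n_approx : nat; n_unbiased : nat; n_warm : nat }.

Fixpoint meter_from {A : Type} (c : calls) (q : prog R V A) :
    prog R V (A * calls) :=
  let: Calls a u w := c in
  match q with
  | Ret x => Ret (x, c)
  | ApproxProx s xi xp k =>
      ApproxProx s xi xp (fun y => meter_from (Calls a.+1 u w) (k y))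
  | UnbiasedProx s xp k =>
      UnbiasedProx s xp (fun y => meter_from (Calls a u.+1 w) (k y))
  | WarmStart r2 k =>
      WarmStart r2 (fun y => meter_from (Calls a u w.+1) (k y))
  | Geometric p k => Geometric p (fun n => meter_from c (k n))
  end.

(* The same algorithm, also returning the number of calls made to each oracle. *)
Definition meter {A : Type} (q : prog R V A) : prog R V (A * calls) :=
  meter_from (Calls 0 0 0) q.

(* [P] holds of the output whatever the oracles and samples return. *)
Fixpoint every_output {A : Type} (q : prog R V A) (P : A -> Prop) : Prop :=
  match q with
  | Ret a => P a
  | ApproxProx _ _ _ k => forall y, every_output (k y) P
  | UnbiasedProx _ _ k => forall y, every_output (k y) P
  | WarmStart _ k => forall y, every_output (k y) P
  | Geometric _ k => forall n, every_output (k n) P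
  end.

End Programs.

Section Semantics.
Context {R : realType} {d : nat}.
Local Notation V := 'rV[R]_d.

(* R^d with its Borel sigma-algebra. *)
Definition borelV := g_sigma_algebraType (@open V).

(* A randomized oracle is a Markov kernel: the law of its answer given its
   inputs. *)
Record oracles : Type := Oracles {
  approx_law : R.-pker (borelV * borelV * borelV) ~> borelV;
  unbiased_law : R.-pker (borelV * borelV) ~> borelV;
  warm_law : R -> probability borelV R }.

(* Expectation of [f] of the output.  Each call draws from the law of the oracle
   at the current inputs, independently of everything drawn before, so the
   expectation is an iterated integral. *)
Fixpoint expect {A : Type} (O : oracles) (q : prog R V A) (f : A -> \bar R) :
    \bar R :=
  match q with
  | Ret a => f a
  | ApproxProx s xi xp k =>
      (\int[approx_law O ((s, xi), xp)]_y expect O (k y) f)%E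
  | UnbiasedProx s xp k =>
      (\int[unbiased_law O (s, xp)]_y expect O (k y) f)%E
  | WarmStart r2 k => (\int[warm_law O r2]_y expect O (k y) f)%E
  | Geometric p k =>
      (\sum_(0 <= n <oo) ((1 - p) * p ^+ n)%:E * expect O (k n) f)%E
  end.

Variables (X : set V) (F : V -> R) (gradF : V -> V) (lam : R).

(* An answer in [X] is an answer whose law gives [X] probability one; [F] is
   integrated over [X] because its values elsewhere are irrelevant. *)
Definition approx_prox_spec (O : oracles) : Prop :=
  forall s xi xp : V, X s -> X xi -> X xp ->
    let xs := prox X F lam s in
    approx_law O ((s, xi), xp) X = 1%E /\
    (\int[approx_law O ((s, xi), xp)]_(x in X) (regularized F lam s x)%:E
       - (regularized F lam s xs)%:E
     <= (8^-1 * (lam * bregman_e xs xi + bregman F gradF xs xp))%:E)%E.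

Definition unbiased_prox_spec (O : oracles) : Prop :=
  forall s xp : V, X s -> X xp ->
    let xs := prox X F lam s in
    (forall i : 'I_d,
       \int[unbiased_law O (s, xp)]_x (x 0 i)%:E = (xs 0 i)%:E)%E /\
    (\int[unbiased_law O (s, xp)]_x (enorm (x - xs) ^+ 2)%:E
     <= ((4 * lam)^-1 * (lam * bregman_e xs s + bregman F gradF xs xp))%:E)%E.

Definition warm_start_spec (O : oracles) (r2 : R) : Prop :=
  warm_law O r2 X = 1%E /\
  (\int[warm_law O r2]_(x in X) (F x)%:E - (F (argmin X F))%:E
   <= (lam * r2)%:E)%E.

End Semantics.
Arguments oracles : clear implicits.

Notation "x <~ q ; k" := (bind q (fun x => k))
  (at level 100, q at next level, right associativity).

Section Algorithms.
Context {R : realType} {d : nat}.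
Local Notation V := 'rV[R]_d.
Local Notation prog := (prog R V).

Definition approx_prox (s xi xp : V) : prog V := ApproxProx s xi xp Ret.
Definition unbiased_prox (s xp : V) : prog V := UnbiasedProx s xp Ret.
Definition warm_start (r2 : R) : prog V := WarmStart r2 Ret.
Definition geometric (p : R) : prog nat := Geometric p Ret.

Definition is_step_sequence (alpha : nat -> R) : Prop :=
  alpha 0 = 1 /\
  forall t, 0 <= alpha t.+1 <= 1 /\
    1 / alpha t.+1 ^+ 2 - 1 / alpha t.+1 = 1 / alpha t ^+ 2.

Variables (X : set V) (alpha : nat -> R).

(* [n] further iterations, starting with iteration [t]. *)
Fixpoint recapp_iter (n t : nat) (x v : V) : prog V :=
  if n is n'.+1 then
    let a := alpha t.+1 in
    let s := (1 - a) *: x + a *: v in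
    x' <~ approx_prox s s x;
    xt <~ unbiased_prox s x;
    recapp_iter n' t.+1 x' (Proj X (v - a^-1 *: (s - xt)))
  else Ret x.

Definition recapp (T : nat) (x0 : V) : prog V := recapp_iter T 0 x0 x0.

Fixpoint epochs (T K : nat) (x : V) : prog V :=
  if K is K'.+1 then x' <~ recapp T x; epochs T K' x' else Ret x.

Definition restarted_recapp (r2 : R) (T K : nat) : prog V :=
  x0 <~ warm_start r2; epochs T K x0.

(* [:: x^(0); ...; x^(n)] for x^(0) = x. *)
Fixpoint refine (s : V) (n : nat) (x : V) : prog (seq V) :=
  if n is n'.+1 then
    x' <~ approx_prox s x x;
    xs <~ refine s n' x';
    Ret (x :: xs)
  else Ret [:: x].

Definition mlmc (p : R) (j0 : nat) (s xp : V) : prog V :=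
  x0 <~ approx_prox s s xp;
  jp <~ geometric p;
  let J := (j0 + jp)%N in
  let pJ := (1 - p) * p ^+ jp in
  xs <~ refine s J x0;
  Ret (nth 0 xs j0 + pJ^-1 *: (nth 0 xs J - nth 0 xs (maxn J.-1 j0))).

End Algorithms.

(* Main.v *)
Require Import Defs.
From mathcomp Require Import all_boot all_order all_algebra.
From mathcomp Require Import all_classical all_reals all_analysis.
From mathcomp Require Import measurable_realfun ring lra.
Import Order.TTheory GRing.Theory Num.Theory.
Import numFieldNormedType.Exports.
Set Implicit Arguments.
Unset Strict Implicit.
Unset Printing Implicit Defensive.
Local Open Scope classical_set_scope.
Local Open Scope ring_scope.

(** Fix an iteration from [(x, v)] with step [a = alpha t.+1], put [b = 1 / a]
    and [s = (1 - a) x + a v], and let [y] be the proximal point of [s] and [z]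
    the minimizer of [F].  First-order optimality of [y], tested at [x] and at
    [z], and convexity show that the potential
      [alpha t ^- 2 (F x - F z) + lam / 2 |v - z|^2]
    does not increase in expectation ([recapp_potential_step]).  Both oracle
    errors are multiples of [lam / 2 |s - y|^2 + V^F_y(x)].  The first summand is
    absorbed by the term [- b^2 lam / 2 |s - y|^2] that moving [v] along [s - y]
    produces, the second by the divergence at [x] that the optimality inequality
    leaves over; the latter needs [a <= 5 / 8], which holds because the first and
    largest step is [(sqrt 5 - 1) / 2].  Strong convexity bounds the initial
    potential by [(1 + lam / gam) (F x - F z)], and [1 / alpha T >= 1 + T / 2],
    so [T = O(sqrt (lam / gam))] iterations divide the expected suboptimality by
    [e] or more ([recapp_upper], [iteration_number]).  The warm start is
    [lam rad^2]-optimal, hence [O(log (lam rad^2 / eps))] epochs suffice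
    ([epochs_upper], [epoch_number]).

    An expectation of a program is an iterated integral whose inner integrands
    are not known to be measurable.  The integral is a difference of two suprema
    over simple functions, and as such it is monotone for all integrands
    ([le_integral_nonmeas]).  So the programs are analysed backwards, from the
    last call to the first: at each call the value of the rest of the program is
    bounded pointwise by an explicit measurable function of the answer, and the
    oracle guarantee bounds the integral of that function ([approx_integral_le],
    [unbiased_integral_le], [warm_integral_le]).

    The rule for UnbiasedProx concerns quadratic polynomials of the answer, and
    MLMC obeys the same rule ([mlmc_upper]).  Each call of ApproxProx divides the
    Bregman divergence [prox_gap] from the proximal point by 8 on average.  The
    level [k] is drawn with probability [p_k] and its increment [D_k] is weighted
    by [1 / p_k]; the terms linear in [D_k] therefore telescope over [k] to the
    displacement from the base point to [y], which removes the bias of the base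
    point, and the squares [|D_k|^2 / p_k] sum because [8^-k] beats [2^k].  With
    [p = 1/2] a run of MLMC calls ApproxProx four times on average, whatever the
    oracles answer, which gives the bound on the expected number of calls
    ([cost_le_restarted]). *)

(** * Euclidean geometry of row vectors *)

Section EuclideanGeometry.
Context {R : realType} {d : nat}.
Local Notation V := 'rV[R]_d.
Implicit Types (x y z u v w : V) (c : R).

Lemma dotC x y : dot x y = dot y x.
Proof. by apply: eq_bigr => i _; rewrite mulrC. Qed.

Lemma dotDr x y z : dot x (y + z) = dot x y + dot x z.
Proof. by rewrite -big_split /=; apply: eq_bigr => i _; rewrite mxE mulrDr. Qed.

Lemma dotZr c x y : dot x (c *: y) = c * dot x y.
Proof. by rewrite mulr_sumr; apply: eq_bigr => i _; rewrite mxE mulrCA. Qed.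

Lemma dotNr x y : dot x (- y) = - dot x y.
Proof. by rewrite -scaleN1r dotZr mulN1r. Qed.

Lemma dotDl x y z : dot (x + y) z = dot x z + dot y z.
Proof. by rewrite ![dot _ z]dotC dotDr. Qed.

Lemma dotZl c x y : dot (c *: x) y = c * dot x y.
Proof. by rewrite ![dot _ y]dotC dotZr. Qed.

Lemma dotNl x y : dot (- x) y = - dot x y.
Proof. by rewrite ![dot _ y]dotC dotNr. Qed.

Definition dotE := (dotDl, dotDr, dotZl, dotZr, dotNl, dotNr).

Lemma dot0l x : dot 0 x = 0.
Proof. by rewrite -(scale0r 0) dotZl mul0r. Qed.

Lemma dot_ge0 x : 0 <= dot x x.
Proof. by apply: sumr_ge0 => i _; rewrite -expr2 sqr_ge0. Qed.

Lemma enormE x : enorm x ^+ 2 = dot x x.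
Proof. by rewrite sqr_sqrtr ?dot_ge0. Qed.

Lemma dot_sqrD x y c :
  dot (x + c *: y) (x + c *: y) = dot x x + 2 * c * dot x y + c ^+ 2 * dot y y.
Proof. by rewrite !dotE (dotC y x); ring. Qed.

Lemma enorm_ge0 x : 0 <= enorm x.
Proof. exact: sqrtr_ge0. Qed.

Lemma enormZ c x : 0 <= c -> enorm (c *: x) = c * enorm x.
Proof.
move=> c0; rewrite /enorm !dotE mulrA sqrtrM; last by rewrite mulr_ge0.
by rewrite -expr2 sqrtr_sqr ger0_norm.
Qed.

Lemma coord_sqr_le x i : x 0 i ^+ 2 <= dot x x.
Proof.
rewrite /dot (bigD1 i) //= -expr2 lerDl.
by apply: sumr_ge0 => j _; rewrite -expr2 sqr_ge0.
Qed.

Lemma coord_le_enorm x i : `|x 0 i| <= enorm x.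
Proof. by rewrite -sqrtr_sqr /enorm ler_wsqrtr // coord_sqr_le. Qed.

Lemma young x y c : 0 < c -> dot x y <= c * dot x x + (4 * c)^-1 * dot y y.
Proof.
move=> c0; have := dot_ge0 (2 * c *: x - y); rewrite !dotE (dotC y x) => h.
have c4 : (4 * c)^-1 * (4 * c) = 1 by rewrite mulVf // lt0r_neq0 // mulr_gt0.
have h4 : 0 < (4 * c)^-1 by rewrite invr_gt0 mulr_gt0.
have := mulr_ge0 (ltW h4) h.
set I := (4 * c)^-1 in c4 h4 *; set a := dot x x; set b := dot x y; set e := dot y y.
move=> h2; have : 0 <= (I * (4 * c)) * (c * a - b) + I * e.
  by apply: le_trans h2 _; rewrite le_eqVlt; apply/orP; left; apply/eqP; ring.
by rewrite c4; lra.
Qed.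

Lemma dot_continuous (f g : V -> V) : continuous f -> continuous g ->
  continuous (fun x => dot (f x) (g x)).
Proof.
move=> cf cg; have co (h : V -> V) i : continuous h ->
    continuous (fun y => h y 0 i).
  move=> ch x.
  exact: (@continuous_comp _ _ _ h (fun y : V => y 0 i) x (ch x)
    (@coord_continuous _ _ _ 0 i (h x))).
rewrite /dot; apply: continuous_big => [|i _ x]; first exact: add_continuous.
exact: (continuousM (co f i cf x) (co g i cg x)).
Qed.

Lemma enorm_continuous (f : V -> V) : continuous f ->
  continuous (fun x => enorm (f x)).
Proof.
move=> cf x.
exact: (@continuous_comp _ _ _ (fun y => dot (f y) (f y)) Num.sqrt x
  (@dot_continuous f f cf cf x) (@sqrt_continuous R _)).
Qed.

(** The sup norm is at most the Euclidean one, so the set lies in a cube. *)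
Lemma closed_diameter_compact (X : set V) r :
  closed X -> diameter_le X r -> compact X.
Proof.
move=> cX dX; have [->|/set0P[x0 Xx0]] := eqVneq X set0; first exact: compact0.
pose A (i : 'I_d) : set R := `[x0 0 i - r, x0 0 i + r]%classic.
apply: (@subclosed_compact _ X [set v : V | forall i, A i (v ord0 i)]) => //.
  by apply: rV_compact => i; exact: segment_compact.
move=> x Xx i; rewrite /A /= in_itv /=.
have := le_trans (coord_le_enorm (x - x0) i) (dX _ _ Xx Xx0).
by rewrite !mxE ler_norml; move=> /andP[]; lra.
Qed.

Lemma convex_in (X : set V) x y c : convex_set X -> X x -> X y ->
  0 <= c <= 1 -> X (c *: x + (1 - c) *: y).
Proof.
move=> cX Xx Xy c01.
have := cX x y (Itv01 (proj1 (andP c01)) (proj2 (andP c01))).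
by rewrite !inE; apply.
Qed.
End EuclideanGeometry.

(** * Minimizers over a compact convex set *)

Section Minimizers.
Context {R : realType} {d : nat}.
Local Notation V := 'rV[R]_d.
Variable X : set V.
Hypotheses (X0 : X !=set0) (kX : compact X) (vX : convex_set X).
Implicit Types (F : V -> R) (gradF : V -> V) (x y z u s : V).

Lemma continuous_argmin F : {within X, continuous F} -> is_argmin X F (argmin X F).
Proof.
move=> cF; apply: (@getPex _ [set x | is_argmin X F x]).
have [c Xc mc] := EVT_min_rV X0 kX cF.
exists c; split; first by rewrite inE in Xc.
by move=> y Xy; apply: mc; rewrite inE.
Qed.

Lemma continuous_bounded F : {within X, continuous F} ->
  exists M, forall x, X x -> `|F x| <= M.
Proof.
move=> cF; have cN : {within X, continuous (fun x => - F x)}.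
  by move=> x; apply: cvgN; exact: cF.
have [a _ ma] := EVT_min_rV X0 kX cF.
have [b _ mb] := EVT_min_rV X0 kX cN.
exists (`|F a| + `|F b|) => x Xx.
have := ma x; have := mb x; rewrite inE => /(_ Xx) h1 /(_ Xx) h2.
have := ler_norm (- F a); have := ler_norm (F b); rewrite normrN.
have := normr_ge0 (F a); have := normr_ge0 (F b).
by rewrite ler_norml; lra.
Qed.

(** Near [x] the increment of [F] is at most [|<gradF x, y - x>| + |y - x|]. *)
Lemma gradient_continuous F gradF :
  is_gradient_on X F gradF -> {within X, continuous F}.
Proof.
move=> gF; apply/subspace_continuousP => x Xx.
apply/cvgrPdist_le => e e0.
pose h (y : V) := `|dot (gradF x) (y - x)| + enorm (y - x).
have cB : continuous (fun y : V => y - x).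
  move=> y; apply: (@continuousB _ _ _ id (cst x)); last exact: cst_continuous.
  exact: (@cvg_id V (nbhs y)).
have cK : continuous (fun _ : V => gradF x) by move=> y; exact: cst_continuous.
have c1 : {for x, continuous (fun y => dot (gradF x) (y - x))}.
  exact: (@dot_continuous _ _ _ _ cK cB x).
have c2 : {for x, continuous (fun y => `|dot (gradF x) (y - x)|)}.
  exact: (@continuous_comp _ _ _ _ (fun r : R => `|r|) x c1 (@norm_continuous _ _ _)).
have c3 : {for x, continuous (fun y => enorm (y - x))}.
  exact: (@enorm_continuous _ _ _ cB x).
have ch : h y @[y --> x] --> h x := continuousD c2 c3.
have h0 : h x = 0.
  by rewrite /h subrr /enorm -(scale0r 0) !dotE !mul0r sqrtr0 normr0 addr0.
rewrite h0 in ch; have := gF x Xx 1 ltr01; move=> g1.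
have {}ch : \forall y \near within X (nbhs x), h y <= e.
  apply: cvg_within.
  by move/cvgrPdist_le : ch => /(_ e e0); apply: filterS => y; rewrite sub0r normrN;
    apply: le_trans; exact: ler_norm.
near=> y.
have h1 : `|F y - F x - dot (gradF x) (y - x)| <= 1 * enorm (y - x) by near: y.
have h2 : h y <= e by near: y.
move: h1 h2; rewrite /h mul1r (distrC (F x)).
set A := dot _ _; set N := enorm _.
have := ler_normD (F y - F x - A) A; rewrite subrK; lra.
Unshelve. all: by end_near.
Qed.

Lemma segment_in x u (t : R) : X x -> X u -> 0 <= t <= 1 -> X (x + t *: (u - x)).
Proof.
move=> Xx Xu t01; have := convex_in vX Xu Xx t01.
by rewrite scalerBl scale1r scalerBr addrCA.
Qed.

(** Moving from [y] by a small fraction [t] of [u - y] changes the regularized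
    objective by [t] times the claimed quantity, up to [o(t)]. *)
Lemma argmin_variational F gradF lam s y u :
  is_gradient_on X F gradF -> is_argmin X (regularized F lam s) y -> X u ->
  0 <= dot (gradF y) (u - y) + lam * dot (y - s) (u - y).
Proof.
move=> gF [Xy my] Xu; set D := _ + _; rewrite leNgt; apply/negP => D0.
set n := enorm (u - y); have n0 : 0 <= n := enorm_ge0 _.
(* [e] controls the error of the gradient and [c] the quadratic term in [t]:
   each stays below [- D / 4]. *)
have [e e0 eE] : exists2 e, 0 < e & e * (n + 1) = - D / 4.
  exists (- D / 4 / (n + 1)); first by apply: divr_gt0; lra.
  by rewrite divfK // lt0r_neq0; lra.
have [r /= r0 br] := (@nbhs_ballP _ _ _ _).1 (gF y Xy _ e0).
have q0 : 0 <= `|lam| * n ^+ 2 by rewrite mulr_ge0 // sqr_ge0.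
have [c c0 cE] : exists2 c, 0 < c & c * (`|lam| * n ^+ 2 + 1) = - D / 4.
  exists (- D / 4 / (`|lam| * n ^+ 2 + 1)); first by apply: divr_gt0; lra.
  by rewrite divfK // lt0r_neq0; lra.
near (0 : R)^'+ => t.
have t0 : 0 < t by near: t; exact: nbhs_right_gt.
have t1 : t <= 1 by near: t; exact: nbhs_right_le.
have tr : t < r / (n + 1) by near: t; apply: nbhs_right_lt; apply: divr_gt0; lra.
have tc : t <= c by near: t; exact: nbhs_right_le.
set z := y + t *: (u - y).
have Xz : X z by apply: segment_in => //; lra.
have zy : z - y = t *: (u - y) by rewrite /z addrC addKr.
have Bz : ball y r z.
  split=> // i j; rewrite /ball /= /ball_ /z !mxE.
  rewrite (_ : _ - _ = - (t * (u i j - y i j))); last by ring.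
  rewrite normrN normrM gtr0_norm //.
  have := coord_le_enorm (u - y) j; rewrite ord1 !mxE -/n => hj.
  apply: (@le_lt_trans _ _ (t * n)); first by rewrite ler_wpM2l // ltW.
  rewrite ltr_pdivlMr in tr; last lra.
  by apply: le_lt_trans tr; rewrite ler_wpM2l ?ltW //; lra.
have := br z Bz Xz; rewrite zy enormZ; last exact: ltW.
rewrite -/n dotZr => h1.
have := my z Xz; rewrite /regularized !enormE.
have -> : z - s = (y - s) + t *: (u - y) by rewrite /z addrAC.
have hn : dot (u - y) (u - y) = n ^+ 2 by rewrite -enormE.
rewrite dot_sqrD hn => h2.
have h3 : F z - F y <= t * dot (gradF y) (u - y) + e * (t * n).
  by have := ler_norm (F z - F y - t * dot (gradF y) (u - y)); lra.
have h4 : 0 <= t * (D + e * n + lam / 2 * t * n ^+ 2) by rewrite /D; lra.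
move: h4; rewrite pmulr_rge0 // => h4.
have h6 : lam * (t * n ^+ 2) <= `|lam| * (t * n ^+ 2).
  by apply: ler_wpM2r; [rewrite mulr_ge0 ?sqr_ge0 // ltW|exact: ler_norm].
have h7 : t * (`|lam| * n ^+ 2) <= c * (`|lam| * n ^+ 2) by rewrite ler_wpM2r.
lra.
Unshelve. all: by end_near.
Qed.

End Minimizers.

(** * Projections and proximal points *)

Section Projection.
Context {R : realType} {d : nat}.
Local Notation V := 'rV[R]_d.
Variable X : set V.
Hypotheses (X0 : X !=set0) (kX : compact X) (vX : convex_set X).
Implicit Types (x y z : V).

(** The projection of [y] is the proximal point of [y] for the zero objective,
    so the variational inequality applies to it and makes it move towards every
    point of [X]. *)
Lemma Proj_prop y :
  X (Proj X y) /\ forall z, X z -> enorm (Proj X y - z) ^+ 2 <= enorm (y - z) ^+ 2.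
Proof.
have cn : {within X, continuous (fun x => enorm (x - y))}.
  apply: continuous_subspaceT; apply: enorm_continuous => x.
  apply: (@continuousB _ _ _ id (cst y)); last exact: cst_continuous.
  exact: (@cvg_id V (nbhs x)).
have [Xp mp] := continuous_argmin X0 kX cn.
split=> // z Xz; rewrite -/(Proj X y) in Xp mp *; set p := Proj X y in Xp mp *.
have am : is_argmin X (regularized (cst 0) 1 y) p.
  split=> // x Xx; rewrite /regularized !add0r ler_wpM2l //.
  by rewrite ler_sqr ?nnegrE ?enorm_ge0 // mp.
have g0 : is_gradient_on X (cst 0) (cst 0 : V -> V).
  move=> x Xx e e0; near=> w.
  by rewrite /= dot0l !subr0 normr0 mulr_ge0 ?enorm_ge0 // ltW.
have := argmin_variational vX g0 am Xz.
rewrite dot0l add0r mul1r !enormE => h.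
have -> : y - z = (p - z) + (- 1) *: (p - y) 
  by apply/rowP => i; rewrite !mxE; ring.
move: h; rewrite dot_sqrD -(opprB p z) dotNr (dotC (p - z)).
by have := dot_ge0 (p - y); lra.
Unshelve. all: by end_near.
Qed.

End Projection.

(** Compactness stands for closedness and bounded diameter: it provides
    minimizers, and bounds on continuous functions. *)
Record prox_setting {R : realType} {d : nat} (X : set 'rV[R]_d) (F : 'rV[R]_d -> R)
    (gradF : 'rV[R]_d -> 'rV[R]_d) (gam lam : R) : Prop := ProxSetting {
  domain_nonempty : X !=set0;
  domain_compact : compact X;
  domain_convex : convex_set X;
  gradient_on_domain : is_gradient_on X F gradF;
  modulus_gt0 : 0 < gam;
  objective_strongly_convex : strongly_convex_on X F gradF gam;
  modulus_le : gam <= lam }.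

Section Proximal.
Context {R : realType} {d : nat}.
Local Notation V := 'rV[R]_d.
Variables (X : set V) (F : V -> R) (gradF : V -> V) (gam lam : R).
Hypothesis pb : prox_setting X F gradF gam lam.
Implicit Types (x y z u s v : V).

Let X0 : X !=set0 := domain_nonempty pb.
Let kX : compact X := domain_compact pb.
Let vX : convex_set X := domain_convex pb.
Let gF : is_gradient_on X F gradF := gradient_on_domain pb.
Let gam0 : 0 < gam := modulus_gt0 pb.
Let scF : strongly_convex_on X F gradF gam := objective_strongly_convex pb.
Let gl : gam <= lam := modulus_le pb.

Lemma lam_gt0 : 0 < lam. Proof. exact: lt_le_trans gam0 gl. Qed.
Let lam0 := lam_gt0.

Lemma objective_continuous : {within X, continuous F}.
Proof. exact: gradient_continuous gF. Qed.
Let cF := objective_continuous.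

Lemma domain_closed : closed X.
Proof. by apply: compact_closed kX; exact: norm_hausdorff. Qed.

Lemma regularized_continuous s : {within X, continuous (regularized F lam s)}.
Proof.
have cn : continuous (fun x => lam / 2 * dot (x - s) (x - s)).
  have cB : continuous (fun y : V => y - s).
    move=> y; apply: (@continuousB _ _ _ id (cst s)); last exact: cst_continuous.
    exact: (@cvg_id V (nbhs y)).
  move=> x; have cD := @dot_continuous _ _ _ _ cB cB x.
  have cK : {for x, continuous (fun _ : V => lam / 2)} by exact: cst_continuous.
  exact: (continuousM cK cD).
have -> : regularized F lam s = F \+ (fun x => lam / 2 * dot (x - s) (x - s)).
  by apply/funext => x; rewrite /regularized enormE.
by move=> x; apply: continuousD; [exact: cF|apply: (continuous_subspaceT cn)].
Qed.

Lemma prox_argmin s : is_argmin X (regularized F lam s) (prox X F lam s).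
Proof. exact/(continuous_argmin X0 kX)/regularized_continuous. Qed.

Lemma prox_in s : X (prox X F lam s).
Proof. exact: (prox_argmin s).1. Qed.

Lemma argmin_min : is_argmin X F (argmin X F).
Proof. exact: (continuous_argmin X0 kX). Qed.

Lemma bregman_ge x x' : X x -> X x' ->
  gam / 2 * dot (x' - x) (x' - x) <= bregman F gradF x x'.
Proof. by move=> Xx /(scF Xx); rewrite enormE /bregman; lra. Qed.

Lemma bregman_ge0 x x' : X x -> X x' -> 0 <= bregman F gradF x x'.
Proof.
move=> Xx Xx'; apply: le_trans (bregman_ge Xx Xx').
by rewrite mulr_ge0 ?dot_ge0 ?divr_ge0 // ltW.
Qed.

Lemma argmin_growth x : X x ->
  gam / 2 * dot (x - argmin X F) (x - argmin X F) <= F x - F (argmin X F).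
Proof.
move=> Xx; have [Xz mz] := argmin_min.
have am : is_argmin X (regularized F 0 0) (argmin X F).
  by split=> // u Xu; rewrite /regularized !mul0r !addr0 mz.
have := argmin_variational vX gF am Xx; rewrite mul0r addr0.
by have := bregman_ge Xz Xx; rewrite /bregman; lra.
Qed.

(** The Bregman divergence of the regularized objective from its minimizer. *)
Definition prox_gap s x : R :=
  let y := prox X F lam s in lam * bregman_e y x + bregman F gradF y x.

Lemma prox_variational s u (y := prox X F lam s) : X u ->
  lam * dot (s - y) (u - y) <= dot (gradF y) (u - y).
Proof.
move=> Xu; have := argmin_variational vX gF (prox_argmin s) Xu.
by rewrite -/y -(opprB s y) dotNl; lra.
Qed.

Lemma prox_gap_le s x : X x ->
  prox_gap s x <= regularized F lam s x - regularized F lam s (prox X F lam s).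
Proof.
move=> Xx; rewrite /prox_gap /regularized /bregman /bregman_e !enormE.
have := prox_variational s Xx; set y := prox _ _ _ _ => /= h.
have -> : x - s = (y - s) + 1 *: (x - y) 
  by apply/rowP => i; rewrite !mxE; ring.
rewrite dot_sqrD; move: h; rewrite -(opprB s y) !dotNl; lra.
Qed.

Lemma prox_gap_ge s x : X x ->
  lam / 2 * dot (x - prox X F lam s) (x - prox X F lam s) <= prox_gap s x.
Proof.
move=> Xx; have := bregman_ge0 (prox_in s) Xx.
by rewrite /prox_gap /bregman_e enormE; lra.
Qed.

Lemma prox_gap_ge0 s x : X x -> 0 <= prox_gap s x.
Proof.
move=> Xx; apply: le_trans (prox_gap_ge s Xx).
by rewrite mulr_ge0 ?dot_ge0 ?divr_ge0 // ltW.
Qed.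

(** The regularizer at [x] is large unless [x] is far from [y]: half of the term
    [lam / 2 |s - y|^2] survives, at the price of counting the suboptimality of
    [x] twice.  This saving is what lets the error of ApproxProx be absorbed. *)
Lemma value_le_regularized s x (y := prox X F lam s) : X x ->
  F x <= F y + lam / 4 * dot (s - y) (s - y)
    + 2 * (regularized F lam s x - regularized F lam s y).
Proof.
move=> Xx.
have := le_trans (prox_gap_ge s Xx) (prox_gap_le s Xx); rewrite -/y.
rewrite /regularized !enormE.
have : 0 <= lam * dot ((x - y) + 1 *: (x - s)) ((x - y) + 1 *: (x - s)).
  by rewrite mulr_ge0 ?dot_ge0 // ltW.
have -> : s - y = (x - y) + (- 1) *: (x - s).
  by apply/rowP => i; rewrite !mxE; ring.
have -> : y - s = (x - s) + (- 1) *: (x - y).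
  by apply/rowP => i; rewrite !mxE; ring.
rewrite !dot_sqrD (dotC (x - s) (x - y)); lra.
Qed.

(** The left-hand side is what the two oracle guarantees leave of the potential
    after one iteration, [g] being the quantity that bounds their errors. *)
Lemma recapp_potential_step x v z a
    (s := (1 - a) *: x + a *: v) (y := prox X F lam s) (b := a^-1)
    (g := lam * bregman_e y s + bregman F gradF y x) :
  X x -> X v -> X z -> 0 < a -> a <= 5 / 8 ->
  b ^+ 2 * (F y + lam / 4 * dot (s - y) (s - y) + 2 * (8^-1 * g) - F z)
  + lam / 2 * (dot (v - b *: (s - y) - z) (v - b *: (s - y) - z)
               + b ^+ 2 * ((4 * lam)^-1 * g))
  <= (b ^+ 2 - b) * (F x - F z) + lam / 2 * dot (v - z) (v - z).
Proof.
move=> Xx Xv Xz a0 a58; have Xy : X y := prox_in s.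
have ab : a * b = 1 by rewrite mulfV // lt0r_neq0.
have b0 : 0 < b by rewrite invr_gt0.
have b85 : 0 <= b * 5 / 8 - 1.
  by have := ler_wpM2r (ltW b0) a58; rewrite ab; lra.
have := bregman_ge0 Xy Xz; have := bregman_ge0 Xy Xx.
have := prox_variational s Xz; have := prox_variational s Xx.
rewrite /g -/y /bregman /bregman_e enormE.
set p := x - y; set q := z - y; set r := s - y.
have -> : v - b *: r - z = (v - z) + (- b) *: r.
  by apply/rowP => i; rewrite !mxE; ring.
rewrite dot_sqrD.
(* The mixture [s] expresses [v - z] through the vectors [x - y], [z - y] and
   [s - y] to which the variational inequalities apply. *)
have vz : v - z = b *: r + (- (b - 1)) *: p + (- 1) *: q.
  apply/rowP => i; rewrite !mxE.
  have e1 : (a * b) * v 0 i = v 0 i by rewrite ab mul1r.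
  have e2 : (a * b) * x 0 i = x 0 i by rewrite ab mul1r.
  lra.
clearbody p q r.
have vzr : dot (v - z) r = b * dot r r - (b - 1) * dot r p - dot r q.
  by rewrite vz !(dotDl, dotZl) (dotC p r) (dotC q r); ring.
rewrite vzr.
have rr : 0 <= dot r r := dot_ge0 _.
set W := dot (v - z) (v - z); set rp := dot r p; set rq := dot r q.
set gp := dot (gradF y) p; set gq := dot (gradF y) q.
move=> h1 h2 h3 h4.
have b1 : 0 <= b - 1 by lra.
(* The claim is the sum of [k1], ..., [k5] with constant coefficients. *)
have k1 := mulr_ge0 (mulr_ge0 (ltW b0) b1) (_ : 0 <= gp - lam * rp).
have k2 := mulr_ge0 (ltW b0) (_ : 0 <= gq - lam * rq).
have k3 := mulr_ge0 (ltW b0) (_ : 0 <= F z - F y - gq).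
have k4 := mulr_ge0 (mulr_ge0 (ltW b0) b85) (_ : 0 <= F x - F y - gp).
have k5 := mulr_ge0 (mulr_ge0 (ltW b0) (ltW b0)) (mulr_ge0 (ltW lam0) rr).
move: (k1 ltac:(lra)) (k2 ltac:(lra)) (k3 ltac:(lra)) (k4 ltac:(lra)) k5.
have variance D g' : lam / 2 * (D + b ^+ 2 * ((4 * lam)^-1 * g')) =
    lam / 2 * D + b ^+ 2 / 8 * g' by field; rewrite lt0r_neq0.
by rewrite variance; lra.
Qed.

End Proximal.

(** * Step sequence *)

Section StepSequence.
Context {R : realType} (alpha : nat -> R).
Hypothesis sa : is_step_sequence alpha.

(** With [b] and [c] the inverses of consecutive steps, [(b - 1/2)^2] equals
    [c^2 + 1/4], so [b] exceeds [c] by at least [1/2].  Positivity comes along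
    because [0^-1 = 0] would force the previous inverse to vanish. *)
Lemma step_inv_ge t : 1 + t%:R / 2 <= (alpha t)^-1 /\ 0 < alpha t.
Proof.
have [a0 aS] := sa; elim: t => [|t [ih ih0]].
  by rewrite a0 invr1 mul0r addr0 ltr01.
have [/andP[at0 at1]] := aS t; rewrite !div1r -!exprVn.
have t0 : 0 <= t%:R :> R by [].
set b := (alpha t.+1)^-1; move=> e.
have b0 : 0 <= b by rewrite invr_ge0.
split.
  set c := (alpha t)^-1 in ih e; rewrite -natr1.
  have : (b - c - 1 / 2) * (b + c - 1 / 2) = 1 / 4 by rewrite -[RHS]addr0; lra.
  move=> h; rewrite leNgt; apply/negP => lt.
  have h1 : 0 <= b + c - 1 / 2 by lra.
  have h2 : b - c - 1 / 2 <= 0 by lra.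
  by have := mulr_le0_ge0 h2 h1; lra.
rewrite lt_neqAle at0 andbT eq_sym; apply/eqP => az.
move: e; rewrite /b az invr0 expr0n /= subr0 => /esym/eqP.
by rewrite expf_eq0 /= invr_eq0 => /eqP z; rewrite z ltxx in ih0.
Qed.

(** The bound [5/8] is just above [(sqrt 5 - 1) / 2 = 0.618...], the value of
    the first step. *)
Lemma step_bounds t : [/\ 0 < alpha t.+1, alpha t.+1 <= 5 / 8 &
  (alpha t.+1)^-1 ^+ 2 - (alpha t.+1)^-1 = (alpha t)^-1 ^+ 2].
Proof.
have [_ /(_ t) [_]] := sa; rewrite !div1r -!exprVn => e.
have [_ a0] := step_inv_ge t.+1; have [c1 _] := step_inv_ge t.
split=> //; move: e; set c := (alpha t)^-1 in c1 *; set b := (alpha t.+1)^-1 => e.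
have b0 : 0 < b by rewrite invr_gt0.
have c2 : 1 <= c by have : 0 <= t%:R :> R by []; lra.
have b85 : 8 / 5 <= b by rewrite leNgt; apply/negP => lt; nra.
have ab : alpha t.+1 * b = 1 by rewrite mulfV // lt0r_neq0.
by nra.
Qed.

End StepSequence.

(** * Integrals of arbitrary functions *)

Section LowerIntegral.
Context {disp : measure_display} {T : measurableType disp} {R : realType}.
Variable mu : {measure set T -> \bar R}.
Import HBNNSimple.
Local Open Scope ereal_scope.

Let le_ge0_integral (f g : T -> \bar R) :
  (forall x, 0 <= f x) -> (forall x, f x <= g x) ->
  \int[mu]_x f x <= \int[mu]_x g x.
Proof.
move=> f0 fg; have g0 x : 0 <= g x := le_trans (f0 x) (fg x).
rewrite !ge0_integralTE //; apply: le_ereal_sup => _ [h hf <-].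
by exists h => // x; apply: le_trans (fg x).
Qed.

(** The integrals of the positive and of the negative part are suprema over the
    simple functions below them, and these are monotone without measurability. *)
Lemma le_integral_nonmeas (D : set T) (f g : T -> \bar R) :
  (forall x, D x -> f x <= g x) ->
  \int[mu]_(x in D) f x <= \int[mu]_(x in D) g x.
Proof.
move=> fg; rewrite integralE [leRHS]integralE; apply: leeB.
  rewrite !(integral_mkcond D); apply: le_ge0_integral => x.
    by rewrite patchE; case: ifP => // _; exact: funepos_ge0.
  rewrite !patchE; case: ifP => // /set_mem Dx.
  by rewrite !funeposE le_max2 // fg.
rewrite !(integral_mkcond D); apply: le_ge0_integral => x.
  by rewrite patchE; case: ifP => // _; exact: funeneg_ge0.
rewrite !patchE; case: ifP => // /set_mem Dx.
by rewrite !funenegE le_max2 // leeN2 fg.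
Qed.

Let ge0_integral_concentrated (D : set T) (f : T -> \bar R) :
  measurable D -> mu (~` D) = 0 -> (forall x, 0 <= f x) ->
  \int[mu]_x f x = \int[mu]_(x in D) f x.
Proof.
move=> mD D0 f0; apply/eqP; rewrite eq_le; apply/andP; split; last first.
  rewrite integral_mkcond; apply: le_ge0_integral => x; rewrite patchE.
    by case: ifP.
  by case: ifP.
rewrite ge0_integralTE //; apply: ge_ereal_sup => _ [h hf <-].
rewrite -integralT_nnsfun (@ge0_negligible_integral _ _ _ mu setT (~` D)) //=.
- by rewrite setTD setCK; apply: le_integral_nonmeas => x _.
- exact: measurableC.
- exact/measurable_EFinP.
- by move=> x _; rewrite lee_fin; exact: fun_ge0.
Qed.

(** A simple function below [f] loses nothing when it is cut off outside [D]. *)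
Lemma integral_concentrated (D : set T) (f : T -> \bar R) :
  measurable D -> mu (~` D) = 0 -> \int[mu]_x f x = \int[mu]_(x in D) f x.
Proof.
move=> mD D0; rewrite integralE [RHS]integralE.
by rewrite (ge0_integral_concentrated mD) // (ge0_integral_concentrated mD).
Qed.

End LowerIntegral.

(** * Borel functions and means of bounded functions *)

Section BorelFunctions.
Context {R : realType} {d : nat}.
Local Notation B := (@borelV R d).
Local Notation V := 'rV[R]_d.

Lemma open_borel (U : set V) : open U -> measurable (U : set B).
Proof. by move=> oU; apply: sub_sigma_algebra. Qed.

Lemma closed_borel (X : set V) : closed X -> measurable (X : set B).
Proof. by move/closed_openC/open_borel/measurableC; rewrite setCK. Qed.

Lemma within_continuous_borel (X : set V) (f : V -> R) : closed X ->
  {within X, continuous f} -> measurable_fun (X : set B) (f : B -> R).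
Proof.
move=> cX /continuousP cf; apply: (measurability _ (RGenOpens.measurableE R)).
move=> _ [_ [a [b ->] <-]].
have /cf /open_subspaceP [U oU UX] : open (`]a, b[%classic : set R).
  exact: interval_open.
rewrite setIC -UX; apply: measurableI; [exact: open_borel|exact: closed_borel].
Qed.

Lemma continuous_borel (f : V -> R) : continuous f ->
  measurable_fun [set: B] (f : B -> R).
Proof.
move=> cf; apply: within_continuous_borel; first exact: closedT.
exact: continuous_subspaceT.
Qed.

Lemma coord_borel i : measurable_fun [set: B] (fun x : B => (x : V) 0 i).
Proof. by apply: continuous_borel; exact: coord_continuous. Qed.

Lemma dot_borel (D : set B) (f g : B -> V) :
  (forall i, measurable_fun D (fun x => f x 0 i)) ->
  (forall i, measurable_fun D (fun x => g x 0 i)) ->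
  measurable_fun D (fun x => dot (f x) (g x)).
Proof.
move=> mf mg; rewrite /dot; apply: measurable_sum => i.
exact: measurable_funM.
Qed.

End BorelFunctions.

Section BoundedMean.
Context {R : realType} {d : nat}.
Local Notation B := (@borelV R d).
Local Notation V := 'rV[R]_d.
Variable X : set B.
Hypothesis mX : measurable X.
Implicit Types (f g : B -> R) (c : R).

(** Functions whose mean under a law concentrated on [X] is finite and linear;
    values outside [X] do not matter. *)
Definition bmeas f := measurable_fun X f /\ exists M, forall x, X x -> `|f x| <= M.

Lemma bmeas_cst c : bmeas (fun=> c).
Proof. by split; [exact: measurable_cst|exists `|c|]. Qed.

Lemma bmeasD f g : bmeas f -> bmeas g -> bmeas (fun x => f x + g x).
Proof.
move=> [mf [M hM]] [mg [N hN]]; split; first exact: measurable_funD.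
exists (M + N) => x Xx; apply: le_trans (ler_normD _ _) _.
by rewrite lerD ?hM ?hN.
Qed.

Lemma bmeasM f g : bmeas f -> bmeas g -> bmeas (fun x => f x * g x).
Proof.
move=> [mf [M hM]] [mg [N hN]]; split; first exact: measurable_funM.
by exists (M * N) => x Xx; rewrite normrM ler_pM ?hM ?hN.
Qed.

Lemma bmeasZ c f : bmeas f -> bmeas (fun x => c * f x).
Proof. by move=> bf; apply: bmeasM => //; exact: bmeas_cst. Qed.

Lemma bmeasN f : bmeas f -> bmeas (fun x => - f x).
Proof.
move=> /(bmeasZ (-1)); by under eq_fun do rewrite mulN1r.
Qed.

Lemma bmeasB f g : bmeas f -> bmeas g -> bmeas (fun x => f x - g x).
Proof. by move=> bf bg; apply: bmeasD => //; exact: bmeasN. Qed.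

Lemma bmeas_sum (I : Type) (r : seq I) (f : I -> B -> R) :
  (forall i, bmeas (f i)) -> bmeas (fun x => \sum_(i <- r) f i x).
Proof.
move=> bf; elim: r => [|i r ih].
  by under eq_fun do rewrite big_nil; exact: bmeas_cst.
by under eq_fun do rewrite big_cons; exact: bmeasD.
Qed.

Lemma bmeas_dot (f g : B -> V) :
  (forall i, bmeas (fun x => f x 0 i)) -> (forall i, bmeas (fun x => g x 0 i)) ->
  bmeas (fun x => dot (f x) (g x)).
Proof. by move=> bf bg; apply: bmeas_sum => i; exact: bmeasM. Qed.

Variable mu : {measure set B -> \bar R}.
Hypotheses (muT : mu setT = 1%E) (muX : mu X = 1%E).

Lemma concentrated_compl : mu (~` X) = 0%E.
Proof.
have : mu (X `|` ~` X) = 1%E by rewrite setUv.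
have -> : mu (X `|` ~` X) = (mu X + mu (~` X))%E.
  by apply: measureU => //; [exact: measurableC|rewrite setICr].
rewrite muX; have := measure_ge0 mu (~` X).
case: (mu (~` X)) => [r _|//|//]; rewrite -EFinD => -[h].
by congr EFin; lra.
Qed.

Lemma bmeas_integrable f : bmeas f -> mu.-integrable X (EFin \o f).
Proof.
move=> [mf [M hM]]; apply: measurable_bounded_integrable => //.
  by rewrite muX ltry.
exists M; split; first exact: num_real.
by move=> N MN x Xx; apply: le_trans (hM _ Xx) (ltW MN).
Qed.

Definition mean f : R := (\int[mu]_(x in X) f x)%R.

Lemma meanE f : bmeas f -> (\int[mu]_(x in X) (f x)%:E)%E = (mean f)%:E.
Proof.
by move=> bf; rewrite fineK //; apply: integrable_fin_num => //; exact: bmeas_integrable.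
Qed.

Lemma mean_cst c : mean (fun=> c) = c.
Proof. by rewrite /mean Rintegral_cst // muX /= mulr1. Qed.

Lemma meanD f g : bmeas f -> bmeas g -> mean (fun x => f x + g x) = mean f + mean g.
Proof. by move=> bf bg; rewrite /mean RintegralD //; exact: bmeas_integrable. Qed.

Lemma meanZ c f : bmeas f -> mean (fun x => c * f x) = c * mean f.
Proof. by move=> bf; rewrite /mean RintegralZl //; exact: bmeas_integrable. Qed.

Lemma mean_le f g : bmeas f -> bmeas g -> (forall x, X x -> f x <= g x) ->
  mean f <= mean g.
Proof. by move=> bf bg; apply: le_Rintegral => //; exact: bmeas_integrable. Qed.

(** The interface between programs and means: [h], the value of the rest of a
    program, is arbitrary, and only its bound [g] has to be measurable. *)
Lemma integral_le_mean (h : B -> \bar R) g : bmeas g ->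
  (forall x, X x -> (h x <= (g x)%:E)%E) -> (\int[mu]_x h x <= (mean g)%:E)%E.
Proof.
move=> bg hg; rewrite (integral_concentrated _ mX concentrated_compl) -meanE //.
exact: le_integral_nonmeas.
Qed.

Lemma integral_concentrated_cst (h : B -> \bar R) c :
  (forall x, X x -> h x = c%:E) -> (\int[mu]_x h x = c%:E)%E.
Proof.
move=> hc; rewrite (integral_concentrated _ mX concentrated_compl).
rewrite (eq_integral (fun=> c%:E)); last by move=> x; rewrite inE => /hc.
by rewrite integral_cst // muX mule1.
Qed.

End BoundedMean.

(** * Expectations over a geometric variable *)

Section GeometricSums.
Context {R : realType}.
Implicit Types (p M : R).

Lemma geometric_mass p n : \sum_(0 <= k < n) (1 - p) * p ^+ k = 1 - p ^+ n.
Proof.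
elim: n => [|n ih]; first by rewrite big_geq // expr0 subrr.
by rewrite big_nat_recr //= ih exprS; ring.
Qed.

Definition geometric_partial p (h : nat -> \bar R) (n : nat) : \bar R :=
  (\sum_(0 <= k < n) ((1 - p) * p ^+ k)%:E * h k)%E.

Lemma geometric_partial_fin p (r : nat -> R) n :
  geometric_partial p (fun k => (r k)%:E) n =
  (\sum_(0 <= k < n) (1 - p) * p ^+ k * r k)%:E.
Proof.
by rewrite /geometric_partial -sumEFin; apply: eq_bigr => k _; rewrite EFinM.
Qed.

Lemma geometric_partial_le p (h h' : nat -> \bar R) n : 0 <= p < 1 ->
  (forall k, (h k <= h' k)%E) ->
  (geometric_partial p h n <= geometric_partial p h' n)%E.
Proof.
move=> /andP[p0 p1] hh; apply: lee_sum => k _.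
by apply: lee_wpmul2l => //; rewrite lee_fin mulr_ge0 ?exprn_ge0 // subr_ge0 ltW.
Qed.

Lemma geometric_cvg p (h : nat -> \bar R) M : 0 <= p < 1 ->
  (forall k, ((- M)%:E <= h k <= M%:E)%E) -> cvgn (geometric_partial p h).
Proof.
move=> p01 hM; have /andP[p0 p1] := p01; pose r k := fine (h k).
have hr k : h k = (r k)%:E.
  rewrite /r; have := hM k.
  by case: (h k) => [//| |] /andP[]; rewrite ?leeNy_eq ?leye_eq.
have rM k : `|r k| <= M by have := hM k; rewrite hr !lee_fin ler_norml.
have -> : h = fun k => (r k)%:E by apply/funext.
have -> : geometric_partial p (fun k => (r k)%:E) =
    EFin \o series (fun k => (1 - p) * p ^+ k * r k).
  by apply/funext => n; rewrite geometric_partial_fin.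
have : cvgn (series (fun k => (1 - p) * p ^+ k * r k)).
  apply: normed_cvg; apply: (@series_le_cvg _ _ (geometric M p)) => [k|k|k|].
  - exact: normr_ge0.
  - by rewrite /geometric /= mulr_ge0 ?exprn_ge0 //; apply: le_trans (rM k).
  - have pk : 0 <= p ^+ k by rewrite exprn_ge0.
    have q0 : 0 <= (1 - p) * p ^+ k by rewrite mulr_ge0 // subr_ge0 ltW.
    rewrite /geometric /= normrM (ger0_norm q0) [M * _]mulrC ler_pM //.
    by rewrite ler_piMl // gerBl.
  - by apply: is_cvg_geometric_series; rewrite ger0_norm.
move=> /cvg_ex[l hl]; apply/cvg_ex; exists l%:E.
exact: (cvg_comp _ _ hl).
Qed.

(** Bounds on the partial sums pass to the limit only because the series
    converges, for which [h] has to be bounded. *)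
Lemma geometric_sum_le p (h : nat -> \bar R) M (a K : R) : 0 <= p < 1 ->
  (forall k, ((- M)%:E <= h k <= M%:E)%E) ->
  (forall n, (geometric_partial p h n.+1 <= (a + K * p ^+ n)%:E)%E) ->
  (\sum_(0 <= k <oo) ((1 - p) * p ^+ k)%:E * h k <= a%:E)%E.
Proof.
move=> p01 hM ha; have /andP[p0 p1] := p01.
apply/lee_addgt0Pr => e e0.
apply: lime_le; first exact: (geometric_cvg p01 hM).
have : geometric K p @ \oo --> (0 : R).
  by apply: cvg_geometric; rewrite ger0_norm.
move=> /cvgrPdist_le /(_ e e0) [N _ hN]; exists N.+1 => // -[|n] //= Nn.
apply: le_trans (ha n) _; rewrite -EFinD lee_fin lerD2l.
have := hN n Nn; rewrite /geometric /= sub0r normrN.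
by apply: le_trans; exact: ler_norm.
Qed.

Lemma geometric_sum_bounded p (h : nat -> \bar R) M : 0 <= p < 1 -> 0 <= M ->
  (forall k, ((- M)%:E <= h k <= M%:E)%E) ->
  ((- M)%:E <= \sum_(0 <= k <oo) ((1 - p) * p ^+ k)%:E * h k <= M%:E)%E.
Proof.
move=> p01 M0 hM; have /andP[p0 p1] := p01.
have pn n : 0 <= p ^+ n <= 1 by rewrite exprn_ge0 // exprn_ile1 // ltW.
have partial c n : geometric_partial p (fun=> c%:E) n = (c * (1 - p ^+ n))%:E.
  by rewrite geometric_partial_fin -mulr_suml geometric_mass mulrC.
apply/andP; split.
  apply: lime_ge; first exact: (geometric_cvg p01 hM).
  exists 0%N => // n _ /=.
  apply: le_trans (@geometric_partial_le p (fun=> (- M)%:E) h n p01 _).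
    by rewrite partial lee_fin; have := pn n; nra.
  by move=> k; have /andP[] := hM k.
apply: lime_le; first exact: (geometric_cvg p01 hM).
exists 0%N => // n _ /=.
apply: le_trans (@geometric_partial_le p h (fun=> M%:E) n p01 _) _.
  by move=> k; have /andP[_] := hM k; apply.
by rewrite partial lee_fin; have := pn n; nra.
Qed.

Lemma geometric_sum_cst p (c : R) : 0 <= p < 1 ->
  (\sum_(0 <= k <oo) ((1 - p) * p ^+ k)%:E * c%:E = c%:E)%E.
Proof.
move=> p01; have /andP[p0 p1] := p01; apply/cvg_lim => //.
have -> : (fun n => \sum_(0 <= k < n) ((1 - p) * p ^+ k)%:E * c%:E)%E =
    EFin \o (fun n => c - geometric c p n).
  apply/funext => n; rewrite -[LHS]/(geometric_partial p (fun=> c%:E) n) /=.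
  by rewrite geometric_partial_fin -mulr_suml geometric_mass /geometric /=; congr EFin; ring.
have : (fun n => c - geometric c p n) @ \oo --> c - 0.
  by apply: cvgB; [exact: cvg_cst|apply: cvg_geometric; rewrite ger0_norm].
rewrite subr0 => hl; exact: (cvg_comp _ _ hl).
Qed.

End GeometricSums.

(** * Calculus of programs *)

Section ProgramAlgebra.
Context {R V : Type}.

Lemma implement_bind (A B : Type) impl (q : prog R V A) (h : A -> prog R V B) :
  implement_unbiased impl (bind q h) =
  bind (implement_unbiased impl q) (fun a => implement_unbiased impl (h a)).
Proof.
have bindA (C D E : Type) (p : prog R V C) (f : C -> prog R V D)
      (g : D -> prog R V E) :
    bind (bind p f) g = bind p (fun a => bind (f a) g).
  by elim: p => //= [s xi xp k ih|s xp k ih|r k ih|pp k ih]; f_equal;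
    apply/funext => y; rewrite ih.
elim: q => //= [s xi xp k ih|s xp k ih|r k ih|p k ih]; rewrite ?bindA; f_equal;
  by apply/funext => y; rewrite ih.
Qed.

(** Lets the original algorithm and its MLMC variant share one analysis. *)
Lemma implement_unbiased_prox_id (A : Type) (q : prog R V A) :
  implement_unbiased (fun s xp => UnbiasedProx s xp Ret) q = q.
Proof.
by elim: q => //= [s xi xp k ih|s xp k ih|r k ih|p k ih]; f_equal;
  apply/funext => y; rewrite ih.
Qed.

Lemma meter_from_bind (A B : Type) (q : prog R V A) (h : A -> prog R V B) c :
  meter_from c (bind q h) = bind (meter_from c q) (fun r => meter_from r.2 (h r.1)).
Proof.
elim: q c => //= [a|s xi xp k ih|s xp k ih|r k ih|p k ih] [na nu nw] //=;
  by f_equal; apply/funext => y; rewrite ih.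
Qed.

Lemma every_output_bind (A B : Type) (q : prog R V A) (h : A -> prog R V B) P :
  every_output (bind q h) P <-> every_output q (fun a => every_output (h a) P).
Proof. by elim: q => //= [s xi xp k ih|s xp k ih|r k ih|p k ih]; split=> H y; apply/ih. Qed.

End ProgramAlgebra.

Section Expectation.
Context {R : realType} {d : nat}.
Local Notation V := 'rV[R]_d.
Variable O : oracles R d.

(** Makes the sums over geometric samples converge to genuine expectations. *)
Fixpoint geometric_ok {A : Type} (q : prog R V A) : Prop :=
  match q with
  | Ret _ => True
  | ApproxProx _ _ _ k => forall y, geometric_ok (k y)
  | UnbiasedProx _ _ k => forall y, geometric_ok (k y)
  | WarmStart _ k => forall y, geometric_ok (k y)
  | Geometric p k => 0 <= p < 1 /\ forall n, geometric_ok (k n)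
  end.

Lemma geometric_ok_bind (A B : Type) (q : prog R V A) (h : A -> prog R V B) :
  geometric_ok q -> (forall a, geometric_ok (h a)) ->
  geometric_ok (bind q h).
Proof.
move=> + hh; elim: q => //= [s xi xp k ih|s xp k ih|r k ih|p k ih].
- by move=> hk y; exact: ih.
- by move=> hk y; exact: ih.
- by move=> hk y; exact: ih.
- by move=> [hp hk]; split=> // y; exact: ih.
Qed.

Lemma geometric_ok_meter (A : Type) (q : prog R V A) c :
  geometric_ok q -> geometric_ok (meter_from c q).
Proof.
elim: q c => //= [a|s xi xp k ih|s xp k ih|r k ih|p k ih] [na nu nw] //=.
- by move=> hk y; exact: ih.
- by move=> hk y; exact: ih.
- by move=> hk y; exact: ih.
- by move=> [hp hk]; split=> // y; exact: ih.
Qed.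

Lemma geometric_ok_implement (A : Type) impl (q : prog R V A) :
  (forall s xp, geometric_ok (impl s xp)) -> geometric_ok q ->
  geometric_ok (implement_unbiased impl q).
Proof.
move=> hi; elim: q => //= [s xi xp k ih|s xp k ih|r k ih|p k ih].
- by move=> hk y; exact: ih.
- by move=> hk; apply: geometric_ok_bind => // y; exact: ih.
- by move=> hk y; exact: ih.
- by move=> [hp hk]; split=> // y; exact: ih.
Qed.

Lemma expect_bind (A B : Type) (q : prog R V A) (h : A -> prog R V B) f :
  expect O (bind q h) f = expect O q (fun a => expect O (h a) f).
Proof.
elim: q => //= [s xi xp k ih|s xp k ih|r k ih|p k ih].
- by congr integral; apply/funext.
- by congr integral; apply/funext.
- by congr integral; apply/funext.
- by congr (limn _); apply/funext => n; apply: eq_bigr => i _; rewrite ih.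
Qed.

Lemma probability_integral_cst (mu : {measure set (@borelV R d) -> \bar R}) (c : R) :
  mu setT = 1%E -> (\int[mu]_x (cst c%:E x) = c%:E)%E.
Proof. by move=> mu1; rewrite integral_cst // mu1 mule1. Qed.

Lemma probability_integral_bounded (mu : {measure set (@borelV R d) -> \bar R})
    (h : @borelV R d -> \bar R) (M : R) :
  mu setT = 1%E -> (forall x, ((- M)%:E <= h x <= M%:E)%E) ->
  ((- M)%:E <= \int[mu]_x h x <= M%:E)%E.
Proof.
move=> mu1 hM; apply/andP; split.
  rewrite -(probability_integral_cst (- M) mu1); apply: le_integral_nonmeas => x _.
  by have /andP[] := hM x.
rewrite -(probability_integral_cst M mu1); apply: le_integral_nonmeas => x _.
by have /andP[] := hM x.
Qed.

Let approxT p : approx_law O p setT = 1%E. Proof. exact: prob_kernel. Qed.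
Let unbiasedT p : unbiased_law O p setT = 1%E. Proof. exact: prob_kernel. Qed.
Let warmT r : warm_law O r setT = 1%E. Proof. by rewrite probability_setT. Qed.

Lemma expect_bounded (A : Type) (q : prog R V A) (f : A -> \bar R) (M : R) :
  0 <= M -> geometric_ok q -> (forall a, ((- M)%:E <= f a <= M%:E)%E) ->
  ((- M)%:E <= expect O q f <= M%:E)%E.
Proof.
move=> M0 + fM; elim: q => //= [s xi xp k ih|s xp k ih|r k ih|p k ih].
- by move=> hk; apply: probability_integral_bounded => // y; exact: ih.
- by move=> hk; apply: probability_integral_bounded => // y; exact: ih.
- by move=> hk; apply: (probability_integral_bounded (warmT r)) => y; exact: ih.
- by move=> [hp hk]; apply: geometric_sum_bounded => // n; exact: ih.
Qed.

Lemma expect_cst (A : Type) (q : prog R V A) (c : R) :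
  geometric_ok q -> expect O q (fun=> c%:E) = c%:E.
Proof.
elim: q => //= [s xi xp k ih|s xp k ih|r k ih|p k ih].
- move=> hk; rewrite -[RHS](probability_integral_cst c (approxT (s, xi, xp))).
  by congr integral; apply/funext => y; exact: ih.
- move=> hk; rewrite -[RHS](probability_integral_cst c (unbiasedT (s, xp))).
  by congr integral; apply/funext => y; exact: ih.
- move=> hk; rewrite -[RHS](probability_integral_cst c (warmT r)).
  by congr integral; apply/funext => y; exact: ih.
- move=> [hp hk]; rewrite -[RHS](geometric_sum_cst c hp).
  by congr (limn _); apply/funext => n; apply: eq_bigr => i _; rewrite ih.
Qed.

Lemma expect_ge0 (A : Type) (q : prog R V A) (f : A -> \bar R) :
  geometric_ok q -> (forall a, (0 <= f a)%E) -> (0 <= expect O q f)%E.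
Proof.
move=> + f0; elim: q => //= [s xi xp k ih|s xp k ih|r k ih|p k ih].
- by move=> hk; apply: integral_ge0 => y _; exact: ih.
- by move=> hk; apply: integral_ge0 => y _; exact: ih.
- by move=> hk; apply: integral_ge0 => y _; exact: ih.
- move=> [/andP[p0 p1] hk]; apply: nneseries_ge0 => n _ _.
  apply: mule_ge0; last exact: ih.
  by rewrite lee_fin mulr_ge0 ?exprn_ge0 // subr_ge0 ltW.
Qed.

Lemma expect_le (A : Type) (q : prog R V A) (f g : A -> \bar R) :
  geometric_ok q -> (forall a, (0 <= f a)%E) -> (forall a, (f a <= g a)%E) ->
  (expect O q f <= expect O q g)%E.
Proof.
move=> + f0 fg; elim: q => //= [s xi xp k ih|s xp k ih|r k ih|p k ih].
- by move=> hk; apply: le_integral_nonmeas => y _; exact: ih.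
- by move=> hk; apply: le_integral_nonmeas => y _; exact: ih.
- by move=> hk; apply: le_integral_nonmeas => y _; exact: ih.
- move=> [/andP[p0 p1] hk].
  have w0 n : (0 <= ((1 - p) * p ^+ n)%:E)%E.
    by rewrite lee_fin mulr_ge0 ?exprn_ge0 // subr_ge0 ltW.
  apply: lee_nneseries => n; last by move=> _; apply: lee_wpmul2l => //; exact: ih.
  by move=> _ _; apply: mule_ge0 => //; exact: expect_ge0.
Qed.

(** The expected number of calls to ApproxProx is at most [m].  The meter may
    start anywhere and an allowance [a] for later calls is carried along, so that
    the property composes under [bind]. *)
Definition cost_le {A : Type} (q : prog R V A) (m : R) : Prop :=
  geometric_ok q /\ forall c (a : R), 0 <= a ->
  (expect O (meter_from c q) (fun r => ((n_approx r.2)%:R + a)%:E)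
   <= ((n_approx c)%:R + a + m)%:E)%E.

Lemma cost_le_Ret (A : Type) (x : A) : cost_le (Ret x) 0.
Proof. by split=> // -[na nu nw] a a0 /=; rewrite addr0. Qed.

Lemma cost_le_bind (A B : Type) (q : prog R V A) (h : A -> prog R V B) m m' :
  0 <= m' -> cost_le q m -> (forall a, cost_le (h a) m') ->
  cost_le (bind q h) (m + m').
Proof.
move=> m'0 [gq hq] hh; split.
  by apply: geometric_ok_bind => // a; exact: (hh a).1.
move=> c a a0; rewrite meter_from_bind expect_bind.
apply: le_trans (expect_le (geometric_ok_meter c gq) _ _) _; last first.
- by apply: le_trans (hq c (a + m') (addr_ge0 a0 m'0)) _; rewrite lee_fin; lra.
- by move=> r /=; apply: le_trans ((hh r.1).2 r.2 a a0) _; rewrite lee_fin; lra.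
- move=> r; apply: expect_ge0; first exact: geometric_ok_meter (hh r.1).1.
  by move=> r'; rewrite lee_fin addr_ge0.
Qed.

Lemma cost_le_approx s xi xp : cost_le (approx_prox s xi xp) 1.
Proof.
split=> // -[na nu nw] a a0 /=.
by rewrite (probability_integral_cst _ (approxT _)) lee_fin -natr1; lra.
Qed.

Lemma cost_le_warm r : cost_le (warm_start r) 0.
Proof.
split=> // -[na nu nw] a a0 /=.
by rewrite (probability_integral_cst _ (warmT _)) lee_fin addr0.
Qed.

(** A geometric variable with [p = 1/2] has mean 1. *)
Lemma cost_le_geometric_half (A : Type) (k : nat -> prog R V A) m : 0 <= m ->
  (forall n, cost_le (k n) (m + n%:R)) -> cost_le (Geometric 2^-1 k) (m + 1).
Proof.
have half01 : 0 <= (2^-1 : R) < 1 by lra.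
move=> m0 hk; split; first by split=> // n; exact: (hk n).1.
move=> [na nu nw] a a0 /=; set c := Calls na nu nw; set b := na%:R + a + m.
(* The partial sums never exceed [b + 1], so no limit has to be computed. *)
have sum n : \sum_(0 <= i < n) (1 - 2^-1) * 2^-1 ^+ i * (b + i%:R) =
    b + 1 - (b + 1 + n%:R) * (2^-1 : R) ^+ n.
  elim: n => [|n ih]; first by rewrite big_geq // expr0; lra.
  rewrite big_nat_recr //= ih exprS -[n.+1%:R]natr1; set x := _ ^+ n; lra.
have b0 : 0 <= b by rewrite !addr_ge0.
apply: lime_le.
  apply: is_cvg_nneseries => n _ _; apply: mule_ge0.
    by rewrite lee_fin mulr_ge0 ?exprn_ge0; lra.
  apply: expect_ge0; first exact: geometric_ok_meter (hk n).1.
  by move=> r; rewrite lee_fin addr_ge0.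
exists 0%N => // n _ /=.
apply: le_trans (@geometric_partial_le _ 2^-1 _ (fun i => (b + i%:R)%:E) n half01 _) _.
  by move=> i; apply: le_trans ((hk i).2 c a a0) _; rewrite /b lee_fin /=; lra.
rewrite geometric_partial_fin sum lee_fin.
have : 0 <= (b + 1 + n%:R) * (2^-1 : R) ^+ n.
  by rewrite mulr_ge0 ?exprn_ge0 ?addr_ge0 //; lra.
by rewrite /b; lra.
Qed.

End Expectation.

(** * Oracle guarantees as bounds on integrals *)

Section OracleRules.
Context {R : realType} {d : nat}.
Local Notation V := 'rV[R]_d.
Local Notation B := (@borelV R d).
Variables (X : set V) (F : V -> R) (gradF : V -> V) (gam lam : R).
Hypothesis pb : prox_setting X F gradF gam lam.
Variable O : oracles R d.
Implicit Types (x y z u s v w : V).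

Lemma domain_borel : measurable (X : set B).
Proof. by apply: closed_borel; exact: domain_closed pb. Qed.
Let mX := domain_borel.

Lemma bmeas_continuous (f : V -> R) : {within X, continuous f} -> bmeas X f.
Proof.
move=> cf; split; first exact: (within_continuous_borel (domain_closed pb)).
exact: (continuous_bounded (domain_nonempty pb) (domain_compact pb)).
Qed.

Lemma bmeas_coord i : bmeas X (fun x : V => x 0 i).
Proof.
apply: bmeas_continuous; apply: continuous_subspaceT.
exact: coord_continuous.
Qed.

Lemma bmeas_coordB u i : bmeas X (fun x : V => (x - u) 0 i).
Proof.
have -> : (fun x : V => (x - u) 0 i) = (fun x : V => x 0 i - u 0 i).
  by apply/funext => x; rewrite !mxE.
by apply: bmeasB => //; [exact: bmeas_coord|exact: bmeas_cst].
Qed.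

Lemma bmeas_dotB u w : bmeas X (fun x : V => dot w (x - u)).
Proof.
by apply: bmeas_dot => // i; [exact: bmeas_cst|exact: bmeas_coordB].
Qed.

Lemma bmeas_sqB u : bmeas X (fun x : V => dot (x - u) (x - u)).
Proof. by apply: bmeas_dot => // i; exact: bmeas_coordB. Qed.

Lemma bmeas_objective : bmeas X F.
Proof. by apply: bmeas_continuous; exact: objective_continuous pb. Qed.

Lemma bmeas_regularized s : bmeas X (regularized F lam s).
Proof. by apply: bmeas_continuous; exact: regularized_continuous pb _. Qed.

Lemma bmeas_prox_gap s : bmeas X (prox_gap X F gradF lam s).
Proof.
rewrite /prox_gap; set y := prox _ _ _ _.
apply: bmeasD => //.
  apply: bmeasZ => //; rewrite /bregman_e.
  by under eq_fun do rewrite enormE; apply: bmeasZ => //; exact: bmeas_sqB.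
apply: bmeasB => //; last exact: bmeas_dotB.
by apply: bmeasB => //; [exact: bmeas_objective|exact: bmeas_cst].
Qed.

Let mean_affine (mu : {measure set B -> \bar R}) f a b c :
  mu X = 1%E -> bmeas X f ->
  mean X mu (fun x => a + b * (f x - c)) = a + b * (mean X mu f - c).
Proof.
move=> muX bf.
rewrite (meanD mX muX (bmeas_cst X a)); last first.
  by apply: bmeasZ => //; apply: bmeasB => //; exact: bmeas_cst.
rewrite (mean_cst mX muX) meanZ //; last by apply: bmeasB => //; exact: bmeas_cst.
by rewrite (meanD mX muX bf (bmeas_cst X (- c))) (mean_cst mX muX).
Qed.

(** The guarantee is linear in the mean of the regularized objective, so it
    bounds any integrand that is affine in it. *)
Lemma approx_integral_le s xi xp (h : V -> \bar R) a b
    (y := prox X F lam s) :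
  approx_prox_spec X F gradF lam O -> X s -> X xi -> X xp -> 0 <= b ->
  (forall x, X x ->
    (h x <= (a + b * (regularized F lam s x - regularized F lam s y))%:E)%E) ->
  (\int[approx_law O (s, xi, xp)]_x h x <=
    (a + b * (8^-1 * (lam * bregman_e y xi + bregman F gradF y xp)))%:E)%E.
Proof.
move=> sp Xs Xxi Xxp b0 hh; have [muX hmu] := sp s xi xp Xs Xxi Xxp.
have br := bmeas_regularized s.
apply: (le_trans (integral_le_mean mX (prob_kernel _) muX _ hh)).
  apply: bmeasD => //; first exact: bmeas_cst.
  by apply: bmeasZ => //; apply: bmeasB => //; exact: bmeas_cst.
rewrite lee_fin mean_affine // lerD2l ler_wpM2l //.
by move: hmu; rewrite (meanE mX muX br) -EFinB lee_fin.
Qed.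

Lemma warm_integral_le r2 (h : V -> \bar R) a b :
  warm_start_spec X F lam O r2 -> 0 <= b ->
  (forall x, X x -> (h x <= (a + b * (F x - F (argmin X F)))%:E)%E) ->
  (\int[warm_law O r2]_x h x <= (a + b * (lam * r2))%:E)%E.
Proof.
move=> [muX hmu] b0 hh; have bF := bmeas_objective.
have muT : warm_law O r2 setT = 1%E by rewrite probability_setT.
apply: (le_trans (integral_le_mean mX muT muX _ hh)).
  apply: bmeasD => //; first exact: bmeas_cst.
  by apply: bmeasZ => //; apply: bmeasB => //; exact: bmeas_cst.
rewrite lee_fin mean_affine // lerD2l ler_wpM2l //.
by move: hmu; rewrite (meanE mX muX bF) -EFinB lee_fin.
Qed.

(** Unbiasedness kills the linear term and the variance bounds the quadratic one.
    The answer may lie anywhere in the space: here integrability comes from the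
    finite second moment. *)
Lemma unbiased_integral_le s xp (h : V -> \bar R) a w b
    (y := prox X F lam s) :
  unbiased_prox_spec X F gradF lam O -> X s -> X xp -> 0 <= b ->
  (forall x, (h x <= (a + dot w (x - y) + b * dot (x - y) (x - y))%:E)%E) ->
  (\int[unbiased_law O (s, xp)]_x h x <=
    (a + b * ((4 * lam)^-1 * (lam * bregman_e y s + bregman F gradF y xp)))%:E)%E.
Proof.
move=> sp Xs Xxp b0 hh; have [mh sq] := sp s xp Xs Xxp.
rewrite -/y in mh sq; set mu := unbiased_law O (s, xp) in mh sq *.
set v := (4 * lam)^-1 * _ in sq *.
have muT : mu setT = 1%E := prob_kernel _.
pose q (x : B) : R := dot ((x : V) - y) ((x : V) - y).
have mc i : measurable_fun [set: B] (fun x : B => ((x : V) - y) 0 i).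
  have -> : (fun x : B => ((x : V) - y) 0 i) = (fun x : B => (x : V) 0 i - y 0 i).
    by apply/funext => x; rewrite !mxE.
  by apply: measurable_funB; [exact: coord_borel|exact: measurable_cst].
have mq : measurable_fun setT q by apply: dot_borel => i; exact: mc.
have q0 x : 0 <= q x := dot_ge0 _.
have sq' : (\int[mu]_x (q x)%:E <= v%:E)%E.
  by apply: le_trans sq; apply: le_integral_nonmeas => x _; rewrite enormE.
have iq : mu.-integrable setT (EFin \o q).
  apply/integrableP; split; first exact/measurable_EFinP.
  apply: le_lt_trans (ltry v); apply: le_trans sq'.
  by apply: le_integral_nonmeas => x _; rewrite /= ger0_norm.
have ic c : mu.-integrable setT (EFin \o (fun=> c)).
  apply: measurable_bounded_integrable => //; first by rewrite muT ltry.
  exists `|c|; split; first exact: num_real.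
  by move=> N cN x _; exact: ltW.
have int_i i : mu.-integrable setT (EFin \o (fun x : B => ((x : V) - y) 0 i)).
  have i1 : mu.-integrable setT (fun x : B => ((1 + q x)%R)%:E).
    exact: (integrableD measurableT (ic 1) iq).
  apply: le_integrable i1 => //; first exact/measurable_EFinP.
  move=> x _ /=; rewrite lee_fin (ger0_norm (_ : 0 <= 1 + q x)); last first.
    by have := q0 x; lra.
  have := coord_sqr_le ((x : V) - y) i; rewrite -/(q x) -(real_normK (num_real _)).
  set t := `|_|; move=> ht; have := sqr_ge0 (t - 1).
  have := normr_ge0 (((x : V) - y) 0 i).
  by rewrite -/t; nra.
have zi i : (\int[mu]_x ((((x : V) - y) 0 i)%:E) = 0)%E.
  have ix : mu.-integrable setT (EFin \o (fun x : B => (x : V) 0 i)).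
    have := integrableD measurableT (int_i i) (ic (y 0 i)).
    by apply: eq_integrable => // x _; rewrite /= -EFinD !mxE subrK.
  have -> : (\int[mu]_x (((x : V) - y) 0 i)%:E)%E =
      (\int[mu]_x ((x : V) 0 i)%:E - \int[mu]_x (y 0 i)%:E)%E.
    rewrite -(integralB_EFin measurableT ix (ic (y 0 i))).
    by apply: eq_integral => x _; rewrite -EFinB !mxE.
  by rewrite mh integral_cst // muT mule1 -EFinB subrr.
have lin (r : seq 'I_d) : mu.-integrable setT
      (EFin \o (fun x : B => \sum_(i <- r) w 0 i * ((x : V) - y) 0 i)) /\
    (\int[mu]_x (\sum_(i <- r) w 0 i * ((x : V) - y) 0 i)%:E = 0)%E.
  elim: r => [|i r [ir zr]].
    split; first by apply: eq_integrable (ic 0) => // x _ /=; rewrite big_nil.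
    by rewrite integral0_eq // => x _; rewrite big_nil.
  have iz := integrableZl measurableT (w 0 i) (int_i i).
  split.
    apply: eq_integrable (integrableD measurableT iz ir) => // x _ /=.
    by rewrite big_cons EFinD EFinM.
  under eq_integral do rewrite big_cons EFinD EFinM.
  rewrite (integralD measurableT iz ir) zr (integralZl measurableT (int_i i)).
  by rewrite (zi i) mule0 adde0.
(* The inner product is summed coordinate by coordinate. *)
have [iw zw] := lin (index_enum 'I_d).
have ib := integrableZl measurableT b iq.
apply: (@le_trans _ _ (\int[mu]_x (a + dot w ((x : V) - y) + b * q x)%:E)%E).
  by apply: le_integral_nonmeas => x _; exact: hh.
have -> : (\int[mu]_x (a + dot w ((x : V) - y) + b * q x)%:E)%E =
    (a%:E + b%:E * \int[mu]_x (q x)%:E)%E.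
  under eq_integral do rewrite !EFinD EFinM.
  rewrite (integralD measurableT (integrableD measurableT (ic a) iw) ib).
  rewrite (integralD measurableT (ic a) iw) zw adde0 integral_cst // muT mule1.
  by rewrite integralZl.
by rewrite EFinD leeD2l // EFinM lee_wpmul2l.
Qed.

End OracleRules.

(** * The MLMC estimator *)

Section MLMC.
Context {R : realType} {d : nat}.
Local Notation V := 'rV[R]_d.
Local Notation B := (@borelV R d).
Variables (X : set V) (F : V -> R) (gradF : V -> V) (gam lam : R).
Hypothesis pb : prox_setting X F gradF gam lam.
Variable O : oracles R d.
Hypothesis aspec : approx_prox_spec X F gradF lam O.
Variable s : V.
Hypothesis Xs : X s.
Implicit Types (x y z u v w : V).

Let mX := domain_borel pb.
Let lam0 : 0 < lam := lam_gt0 pb.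
Let y : V := prox X F lam s.
Let e : V -> R := prox_gap X F gradF lam s.
(* The law of the next iterate of the refinement chain. *)
Let kappa (z : V) := approx_law O (s, z, z).
Let kappaT z : kappa z setT = 1%E. Proof. exact: prob_kernel. Qed.
Let kappaX z (Xz : X z) : kappa z X = 1%E. Proof. exact: (aspec Xs Xz Xz).1. Qed.

(** Measurability of the kernel in its inputs is inherited by the means, which
    makes the means of all later iterates measurable functions of the first. *)
Lemma bmeas_kernel_mean (f : V -> R) : bmeas X f ->
  bmeas X (fun z => mean X (kappa z) f).
Proof.
move=> bf; have [mf [M hM]] := bf; split; last first.
  exists M => z Xz; have muX := kappaX Xz.
  have hb c : mean X (kappa z) (fun=> c) = c := mean_cst mX muX c.
  rewrite ler_norml; apply/andP; split.
    rewrite -[leLHS]hb; apply: (mean_le mX muX) => //; first exact: bmeas_cst.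
    by move=> x /hM; rewrite ler_norml => /andP[].
  rewrite -[leRHS]hb; apply: (mean_le mX muX) => //; first exact: bmeas_cst.
  by move=> x /hM; rewrite ler_norml => /andP[].
(* Shifting by the bound [M] and cutting off outside [X] turns [f] into a
   nonnegative function on the whole space. *)
pose g (x : B) : \bar R := (((fun x => f x + M) \_ X) x)%:E.
have mg : measurable_fun [set: B] g.
  apply/measurable_EFinP; apply/(measurable_restrictT _ mX).
  by apply: measurable_funD => //; exact: measurable_cst.
have g0 x : (0 <= g x)%E.
  rewrite /g patchE lee_fin; case: ifP => // /set_mem /hM.
  by rewrite ler_norml => /andP[]; lra.
have mk U : measurable U -> measurable_fun [set: B] (fun z : B => kappa z U).
  move=> mU; have := measurable_kernel (approx_law O) U mU.
  have mp : measurable_fun [set: B] (fun z : B => ((s : B, z), z)).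
    by apply: measurable_fun_pair => //; apply: measurable_fun_pair => //;
      exact: measurable_cst.
  by move=> mU'; exact: (measurableT_comp mU' mp).
have mi := measurable_fun_integral_kernel mk g0 mg.
have mfi : measurable_fun (X : set B)
    (fun z : B => fine (\int[kappa z]_x g x)%E - M).
  apply: measurable_funB; last exact: measurable_cst.
  apply: measurable_funTS; apply: measurableT_comp mi.
  exact: fine_measurable.
apply: eq_measurable_fun mfi => z /set_mem Xz; have muX := kappaX Xz.
have bM : bmeas X (fun=> M) := bmeas_cst X M.
have -> : (\int[kappa z]_x g x = (mean X (kappa z) f + M)%:E)%E.
  rewrite (_ : g = (fun x => ((f x + M)%R)%:E) \_ X); last first.
    by apply/funext => x; rewrite /g !patchE; case: ifP.
  rewrite -integral_mkcond (meanE mX muX) ?(meanD mX muX bf bM) ?(mean_cst mX muX) //.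
  exact: bmeasD.
by rewrite /= addrK.
Qed.

Lemma mean_dot (mu : {measure set B -> \bar R}) u (g : V -> V) : mu X = 1%E ->
  (forall i, bmeas X (fun x => g x 0 i)) ->
  mean X mu (fun x => dot u (g x)) = dot u (\row_i mean X mu (fun x => g x 0 i)).
Proof.
move=> muX bg; rewrite /dot.
suff H (r : seq 'I_d) : mean X mu (fun x => \sum_(i <- r) u 0 i * g x 0 i) =
    \sum_(i <- r) u 0 i * mean X mu (fun x => g x 0 i).
  by rewrite H; apply: eq_bigr => i _; rewrite mxE.
elim: r => [|i r ih].
  by under eq_fun do rewrite big_nil; rewrite (mean_cst mX muX) big_nil.
under eq_fun do rewrite big_cons.
rewrite (meanD mX muX (bmeasZ _ (bg i))); last first.
  by apply: bmeas_sum => // j; exact: bmeasZ.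
by rewrite meanZ // ih big_cons.
Qed.

(** The conditional expectation of the [n]-th iterate of the chain given that
    the first one is [z]. *)
Fixpoint chain_mean n (z : V) : V :=
  if n is n'.+1 then \row_i mean X (kappa z) (fun x => chain_mean n' x 0 i) else z.

Lemma bmeas_chain_mean n i : bmeas X (fun z => chain_mean n z 0 i).
Proof.
elim: n i => [|n ih] i /=; first exact: bmeas_coord pb i.
by under eq_fun do rewrite mxE; exact: bmeas_kernel_mean.
Qed.

Lemma mean_chain_mean n z u : X z ->
  mean X (kappa z) (fun x => dot u (chain_mean n x)) = dot u (chain_mean n.+1 z).
Proof. by move=> Xz; rewrite mean_dot //; [exact: kappaX|exact: bmeas_chain_mean]. Qed.

Lemma bmeas_dot_chain_mean n u : bmeas X (fun x => dot u (chain_mean n x)).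
Proof.
by apply: bmeas_dot => // i; [exact: bmeas_cst|exact: bmeas_chain_mean].
Qed.

Let bm_gap : bmeas X e := bmeas_prox_gap pb s.
Let e0 x : X x -> 0 <= e x. Proof. exact: prox_gap_ge0 pb s _. Qed.

(** The right-hand side of the guarantee of ApproxProx is an eighth of the
    Bregman divergence at the input, while the left-hand side dominates the
    divergence at the output by optimality of [y]. *)
Lemma mean_prox_gap z : X z -> mean X (kappa z) e <= 8^-1 * e z.
Proof.
move=> Xz; have muX := kappaX Xz.
have := approx_integral_le pb (h := fun x => (e x)%:E) (a := 0) (b := 1)
  aspec Xs Xz Xz ler01.
rewrite (integral_concentrated _ mX (concentrated_compl mX (kappaT z) muX)).
rewrite (meanE mX muX bm_gap) lee_fin add0r mul1r; apply => x Xx.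
rewrite lee_fin add0r mul1r.
  exact: (prox_gap_le pb s Xx).
Qed.

Lemma sq_le_prox_gap x : X x -> dot (x - y) (x - y) <= 2 / lam * e x.
Proof.
move=> Xx; have := prox_gap_ge pb s Xx; rewrite -/y -/e => h.
rewrite mulrAC ler_pdivlMr //; move: h; rewrite -/(e x); lra.
Qed.

(** The mean of the chain tends to [y]: Young's inequality with a free weight [c]
    turns the linear drift into the divergence, which contracts. *)
Lemma chain_mean_drift n u c z : X z -> 0 < c ->
  dot u (chain_mean n z - y) <=
  c * dot u u + (4 * c)^-1 * (2 / lam * (8^-1 ^+ n * e z)).
Proof.
move=> Xz c0; have ic0 : 0 <= (4 * c)^-1 by rewrite invr_ge0 mulr_ge0 // ltW.
elim: n z Xz => [|n ih] z Xz.
  apply: le_trans (young u (z - y) c0) _; rewrite lerD2l expr0 mul1r.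
  by rewrite ler_wpM2l // sq_le_prox_gap.
have muX := kappaX Xz.
set k := (4 * c)^-1 * (2 / lam * 8^-1 ^+ n).
have l0 : 0 <= 2 / lam by rewrite divr_ge0 // ltW.
have k0 : 0 <= k by rewrite /k mulr_ge0 // mulr_ge0 // exprn_ge0 // invr_ge0.
have := mean_le mX muX (f := fun x => dot u (chain_mean n x) + (- dot u y))
  (g := fun x => c * dot u u + k * e x).
rewrite (meanD mX muX (bmeas_dot_chain_mean n u) (bmeas_cst X _)).
rewrite (meanD mX muX (bmeas_cst X _) (bmeasZ _ bm_gap)) !(mean_cst mX muX) meanZ //.
rewrite mean_chain_mean // => H.
have {}H : dot u (chain_mean n.+1 z) - dot u y <= c * dot u u + k * mean X (kappa z) e.
  apply: H.
  - by apply: bmeasD; [exact: bmeas_dot_chain_mean|exact: bmeas_cst].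
  - by apply: bmeasD; [exact: bmeas_cst|exact: bmeasZ].
  - by move=> x /ih; rewrite dotDr dotNr /k; lra.
rewrite dotDr dotNr; apply: le_trans H _; rewrite lerD2l.
apply: le_trans (ler_wpM2l k0 (mean_prox_gap Xz)) _.
by rewrite /k exprS; lra.
Qed.

Lemma expect_refineS n z (H : seq V -> \bar R) :
  expect O (refine s n.+1 z) H =
  (\int[kappa z]_x expect O (refine s n x) (fun l => H (z :: l)))%E.
Proof.
by rewrite /=; congr integral; apply/funext => x; rewrite expect_bind.
Qed.

(** Only the last two iterates enter.  The mean of their difference is kept
    exactly, for later telescoping; their squared distance is bounded by the two
    divergences, [4 / lam * (1 + 1/8) = 9 / (2 lam)]. *)
Lemma refine_last_step k z (H : seq V -> \bar R) c u b : X z -> 0 <= b ->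
  (forall l v, v = nth 0 (z :: l) k.+1 - nth 0 (z :: l) k ->
    (H (z :: l) <= (c + dot u v + b * dot v v)%:E)%E) ->
  (expect O (refine s k.+1 z) H <=
   (c + dot u (chain_mean k.+1 z - chain_mean k z)
      + b * (9 / (2 * lam) * (8^-1 ^+ k * e z)))%:E)%E.
Proof.
move=> + b0; elim: k z H => [|k ih] z H Xz hH; have muX := kappaX Xz.
  rewrite expect_refineS.
  pose g x := (c - dot u z + b * (4 / lam) * e z) + dot u x + b * (4 / lam) * e x.
  have b1 : bmeas X (fun x => dot u x).
    by have := bmeas_dot_chain_mean 0 u.
  have b2 : bmeas X (fun x => c - dot u z + b * (4 / lam) * e z + dot u x).
    by apply: bmeasD => //; exact: bmeas_cst.
  have bg : bmeas X g by apply: bmeasD => //; exact: bmeasZ.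
  apply: (le_trans (integral_le_mean mX (kappaT z) muX bg _)).
    move=> x Xx; apply: le_trans (hH [:: x] (x - z) erefl) _; rewrite lee_fin /g.
    have h1 := sq_le_prox_gap Xx; have h2 := sq_le_prox_gap Xz.
    have h3 : dot (x - z) (x - z) <=
        2 * dot (x - y) (x - y) + 2 * dot (z - y) (z - y).
      have := dot_ge0 ((x - y) + 1 *: (z - y)).
      have -> : x - z = (x - y) + (-1) *: (z - y).
        by apply/rowP => i; rewrite !mxE; ring.
      by rewrite !dot_sqrD; lra.
    have h4 : dot (x - z) (x - z) <= 4 / lam * e x + 4 / lam * e z by lra.
    by have := ler_wpM2l b0 h4; rewrite (dotDr u) (dotNr u); lra.
  rewrite lee_fin /g (meanD mX muX b2 (bmeasZ _ bm_gap)).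
  rewrite (meanD mX muX (bmeas_cst X _) b1).
  rewrite (mean_cst mX muX) meanZ // (mean_chain_mean 0 u Xz) expr0 mul1r.
  have := mean_prox_gap Xz.
  have q0 : 0 <= b * (4 / lam) by rewrite !mulr_ge0 // invr_ge0 ltW.
  move=> /(ler_wpM2l q0); rewrite dotDr dotNr invfM /=; lra.
rewrite expect_refineS.
pose g x := c + dot u (chain_mean k.+1 x) - dot u (chain_mean k x)
      + b * (9 / (2 * lam)) * 8^-1 ^+ k * e x.
have b1 : bmeas X (fun x => c + dot u (chain_mean k.+1 x)).
  by apply: bmeasD; [exact: bmeas_cst|exact: bmeas_dot_chain_mean].
have b2 : bmeas X (fun x => c + dot u (chain_mean k.+1 x) - dot u (chain_mean k x)).
  by apply: bmeasB => //; exact: bmeas_dot_chain_mean.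
have bg : bmeas X g by apply: bmeasD => //; exact: bmeasZ.
apply: (le_trans (integral_le_mean mX (kappaT z) muX bg _)).
  move=> x Xx; apply: le_trans (ih x (fun l => H (z :: l)) Xx _) _.
    by move=> l v; exact: (hH (x :: l)).
  by rewrite lee_fin /g (dotDr u) (dotNr u); lra.
rewrite lee_fin /g (meanD mX muX b2 (bmeasZ _ bm_gap)) meanZ //.
rewrite (meanD mX muX b1 (bmeasN (bmeas_dot_chain_mean _ _))).
rewrite (meanD mX muX (bmeas_cst X _) (bmeas_dot_chain_mean _ _)).
have -> : mean X (kappa z) (fun x => - dot u (chain_mean k x)) =
    - dot u (chain_mean k.+1 z).
  under eq_fun do rewrite -mulN1r.
  by rewrite meanZ ?mulN1r ?mean_chain_mean //; exact: bmeas_dot_chain_mean.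
rewrite (mean_cst mX muX) mean_chain_mean //.
have q0 : 0 <= b * (9 / (2 * lam)) * 8^-1 ^+ k.
  by rewrite !mulr_ge0 ?exprn_ge0 // invr_ge0 mulr_ge0 // ltW.
have := ler_wpM2l q0 (mean_prox_gap Xz).
rewrite dotDr dotNr exprS; lra.
Qed.


(** [Q k z] is the value of a program whose geometric sample is [k], started at
    [z].  The bounds [G k] need to be individually measurable, so that they can
    be integrated once more, but only their weighted partial sums are small. *)
Definition sums_bounded (Q : nat -> V -> \bar R) (a D K : R) : Prop :=
  exists G : nat -> V -> R,
  [/\ forall k, bmeas X (G k),
      forall k w, X w -> (Q k w <= (G k w)%:E)%E &
      forall n w, X w ->
        \sum_(0 <= k < n.+1) (1 - 2^-1) * 2^-1 ^+ k * G k w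
          <= a + D * e w + K * 2^-1 ^+ n].

Lemma mean_sum (mu : {measure set B -> \bar R}) (n : nat) (c : nat -> R)
    (f : nat -> V -> R) : mu X = 1%E -> (forall k, bmeas X (f k)) ->
  bmeas X (fun x => \sum_(0 <= k < n) c k * f k x) /\
  mean X mu (fun x => \sum_(0 <= k < n) c k * f k x) =
  \sum_(0 <= k < n) c k * mean X mu (f k).
Proof.
move=> muX bf; elim: n => [|n [bn ih]].
  under eq_fun do rewrite big_geq //; rewrite big_geq //.
  by split; [exact: bmeas_cst|exact: mean_cst].
under eq_fun do rewrite big_nat_recr //=; rewrite big_nat_recr //=.
split; first by apply: bmeasD => //; exact: bmeasZ.
by rewrite (meanD mX muX bn (bmeasZ _ (bf n))) ih meanZ.
Qed.

(** One more refinement step in front of the programs. *)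
Lemma sums_bounded_step Q a D K : 0 <= D -> sums_bounded Q a D K ->
  sums_bounded (fun k z => \int[kappa z]_x Q k x)%E a (D / 8) K.
Proof.
move=> D0 [G [bG QG sG]]; exists (fun k z => mean X (kappa z) (G k)); split.
- by move=> k; exact: bmeas_kernel_mean.
- by move=> k z Xz; apply: (integral_le_mean mX (kappaT z) (kappaX Xz)) => // x /QG.
- move=> n z Xz; have muX := kappaX Xz.
  have [bs <-] := mean_sum n.+1 (fun k => (1 - 2^-1) * 2^-1 ^+ k) muX bG.
  set r := K * _.
  have bD : bmeas X (fun x => a + r + D * e x).
    by apply: bmeasD => //; [exact: bmeas_cst|exact: bmeasZ].
  apply: (le_trans (mean_le mX muX bs bD _)).
    by move=> x /(sG n); rewrite -/r; lra.
  rewrite (meanD mX muX (bmeas_cst X _) (bmeasZ _ bm_gap)) (mean_cst mX muX) meanZ //.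
  by have := ler_wpM2l D0 (mean_prox_gap Xz); lra.
Qed.

Lemma refine_prefix (h : nat -> seq V -> \bar R) j a D K : 0 <= D ->
  sums_bounded (fun k z => expect O (refine s k z) (h k)) a D K ->
  sums_bounded (fun k z => expect O (refine s (j + k) z) (fun l => h k (drop j l)))
    a (D * 8^-1 ^+ j) K.
Proof.
move=> D0 H; elim: j => [|j ih].
  rewrite expr0 mulr1; case: H => G [bG QG sG]; exists G; split=> // k w Xw.
  rewrite add0n; under eq_fun do rewrite drop0; exact: QG.
have Dj : 0 <= D * 8^-1 ^+ j by rewrite mulr_ge0 // exprn_ge0 // invr_ge0.
have := sums_bounded_step Dj ih; rewrite exprSr mulrA => -[G [bG QG sG]].
by exists G; split=> // k w Xw; rewrite addSn expect_refineS; exact: QG.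
Qed.

(** The value returned by MLMC as a function of the list of iterates; the
    weight is the inverse of the probability of the sample [k]. *)
Definition mlmc_value (p : R) j0 k (l : seq V) : V :=
  nth 0 l j0 + ((1 - p) * p ^+ k)^-1 *:
    (nth 0 l (j0 + k)%N - nth 0 l (maxn (j0 + k).-1 j0)).

(** The first [j0] iterates do not enter. *)
Lemma mlmc_value_drop p j0 k l : mlmc_value p j0 k l = mlmc_value p 0 k (drop j0 l).
Proof.
rewrite /mlmc_value !nth_drop addn0; congr (_ + _ *: (_ - nth _ _ _)).
case: k => [|k]; first by rewrite !addn0 ?maxn0 ?addn0; exact/maxn_idPr/leq_pred.
by rewrite maxn0 addnS; exact/maxn_idPl/leq_addr.
Qed.

(** At base point [w] the bound at level [k] is a quadratic polynomial in the
    increment [D_k].  Its weighted linear terms telescope to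
    [<U w, chain_mean n w - w>], which tends to [<U w, y - w>]; together with the
    constant term [C w] this leaves [a - b |w - y|^2 <= a].  The weighted squares
    form a geometric series of ratio [1/4]. *)
Lemma estimator_sums_bounded (h : V -> \bar R) a u b : 0 <= b ->
  (forall x, (h x <= (a + dot u (x - y) + b * dot (x - y) (x - y))%:E)%E) ->
  exists K, sums_bounded
    (fun k z => expect O (refine s k z) (fun l => h (mlmc_value 2^-1 0 k l)))
    a (b * (24 / lam)) K.
Proof.
move=> b0 hh; pose C w := a + dot u (w - y) + b * dot (w - y) (w - y).
pose U w := u + (2 * b) *: (w - y).
pose q (k : nat) : R := ((1 - 2^-1) * 2^-1 ^+ k)^-1.
pose r := 9 / (2 * lam).
have r0 : 0 <= r by rewrite /r divr_ge0 // mulr_ge0 // ltW.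
have bC : bmeas X C.
  apply: bmeasD => //; last by apply: bmeasZ => //; exact: bmeas_sqB pb y.
  by apply: bmeasD => //; [exact: bmeas_cst|exact: bmeas_dotB pb y u].
have bU i : bmeas X (fun w => U w 0 i).
  have -> : (fun w => U w 0 i) = (fun w => u 0 i + 2 * b * (w - y) 0 i).
    by apply/funext => w; rewrite !mxE.
  apply: bmeasD => //; first exact: bmeas_cst.
  by apply: bmeasZ => //; exact: bmeas_coordB pb y i.
pose G k w := if k is k'.+1 then
    C w + q k * (dot (U w) (chain_mean k w) - dot (U w) (chain_mean k' w))
      + b * q k ^+ 2 * (r * 8^-1 ^+ k') * e w
  else C w.
have q0 k : 0 < q k by rewrite invr_gt0 mulr_gt0 ?exprn_gt0 //; lra.
have bG k : bmeas X (G k).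
  case: k => [//|k]; apply: bmeasD => //; last exact: bmeasZ.
  apply: bmeasD => //; apply: bmeasZ => //; apply: bmeasB => //;
    by apply: bmeas_dot => // i; exact: bmeas_chain_mean.
have [M1 hM1] := bC.2; have [M2 hM2] := (bmeas_dot bU bU).2; have [M3 hM3] := bm_gap.2.
exists (M1 + M2 + M3 / (2 * lam)), G; split=> //.
- move=> k w Xw; have hest (x D : V) (t : R) : x = w + t *: D ->
      (h x <= (C w + t * dot (U w) D + b * t ^+ 2 * dot D D)%:E)%E.
    move=> ->; apply: le_trans (hh _) _; rewrite lee_fin /C /U.
    have -> : w + t *: D - y = (w - y) + t *: D by rewrite addrAC.
    by rewrite dot_sqrD dotDr dotZr (dotDl u) (dotZl (2 * b)); lra.
  case: k => [|k] /=.
    apply: le_trans (hest _ 0 0 _) _; last by rewrite lee_fin dot0l; lra.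
    by rewrite /mlmc_value /= subrr scaler0 scale0r.
  apply: (le_trans (@refine_last_step k w _ (C w) (q k.+1 *: U w)
    (b * q k.+1 ^+ 2) Xw _ _)).
  + by rewrite mulr_ge0 // sqr_ge0.
  + move=> l v vE; rewrite dotZl; apply: (hest _ v (q k.+1)).
    by rewrite vE /mlmc_value maxn0.
  + by rewrite lee_fin dotZl dotDr dotNr -/r; lra.
move=> n w Xw.
have sumE : \sum_(0 <= k < n.+1) (1 - 2^-1) * 2^-1 ^+ k * G k w =
    (1 - 2^-1 ^+ n.+1) * C w + dot (U w) (chain_mean n w) - dot (U w) w
    + b * r * e w * (16 / 3) * (1 - 4^-1 ^+ n).
  elim: n => [|n ih]; first by rewrite big_nat1 /= expr0 expr1; lra.
  rewrite big_nat_recr //= ih.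
  have pq : (1 - 2^-1) * 2^-1 ^+ n.+1 * q n.+1 = 1.
    by rewrite divff // lt0r_neq0 // mulr_gt0 ?exprn_gt0 //; lra.
  have qE : q n.+1 * 8^-1 ^+ n = 4 * 4^-1 ^+ n.
    rewrite /q; have -> : (8^-1 : R) = 2^-1 * 4^-1 by field.
    rewrite exprMn exprS; have : (2^-1 : R) ^+ n != 0 by rewrite expf_neq0 // invr_neq0.
    by move: (2^-1 ^+ n) (4^-1 ^+ n) => A A' A0; field.
  (* [P] is the probability of the level and [Q] its inverse. *)
  have split_term (P Q A D z b' r' e' : R) :
      P * (A + Q * D + b' * Q ^+ 2 * (r' * z) * e') =
      P * A + (P * Q) * D + (P * Q) * (Q * z) * (b' * r' * e') by ring.
  rewrite split_term pq qE (exprS _ n.+1) (exprS 4^-1).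
  by move: (2^-1 ^+ n.+1) (4^-1 ^+ n) => A A'; lra.
rewrite sumE.
have tn : 0 < (2^-1 : R) ^+ n <= 1.
  by rewrite exprn_gt0 ?exprn_ile1 //; lra.
set t := 2^-1 ^+ n in tn *; have /andP[t0 t1] := tn.
(* The weight [2^-n] in Young's inequality makes both resulting terms vanish
   in the limit, since [8^-n / 2^-n = 4^-n]. *)
have := chain_mean_drift n (U w) Xw t0; rewrite dotDr dotNr.
have -> : (4 * t)^-1 * (2 / lam * (8^-1 ^+ n * e w)) = t ^+ 2 * (e w / (2 * lam)).
  have -> : (8^-1 : R) ^+ n = t ^+ 3.
    by rewrite /t -exprM mulnC exprM; congr (_ ^+ _); field.
  by field; rewrite !lt0r_neq0.
have hE : t ^+ 2 * (e w / (2 * lam)) <= t * (M3 / (2 * lam)).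
  have el : e w / (2 * lam) <= M3 / (2 * lam).
    rewrite ler_pM2r ?invr_gt0 ?mulr_gt0 //.
    by apply: le_trans (hM3 _ Xw); exact: ler_norm.
  have e1 : 0 <= e w / (2 * lam) by rewrite divr_ge0 ?e0 // mulr_ge0 // ltW.
  have t2 : 0 <= 1 - t by lra.
  have := mulr_ge0 (mulr_ge0 (ltW t0) t2) e1; have := ler_wpM2l (ltW t0) el; lra.
have hC : - (2^-1 ^+ n.+1 * C w) <= t * M1.
  rewrite exprS -/t; have := hM1 _ Xw; rewrite ler_norml => /andP[c1 c2].
  have := ler_wpM2l (ltW t0) c1; have : 0 <= M1 by lra.
  by move=> m1; have := mulr_ge0 (ltW t0) m1; lra.
have hU : t * dot (U w) (U w) <= t * M2.
  by apply: ler_wpM2l; [exact: ltW|exact: le_trans (ler_norm _) (hM2 _ Xw)].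
have hCU : C w + dot (U w) y - dot (U w) w <= a.
  have k1 : dot (U w) (w - y) = dot (U w) w - dot (U w) y by rewrite dotDr dotNr.
  have k2 : dot (U w) (w - y) = dot u (w - y) + 2 * b * dot (w - y) (w - y).
    by rewrite /U (dotDl u) (dotZl (2 * b)).
  by rewrite k2 in k1; have := mulr_ge0 b0 (dot_ge0 (w - y)); rewrite /C; lra.
have h4 : b * r * e w * (16 / 3) * (1 - 4^-1 ^+ n) <= b * (24 / lam) * e w.
  have -> : b * (24 / lam) * e w = b * r * e w * (16 / 3).
    by rewrite /r; field; rewrite lt0r_neq0.
  have w0 : 0 <= b * r * e w := mulr_ge0 (mulr_ge0 b0 r0) (e0 Xw).
  have f0 : 0 <= (4^-1 : R) ^+ n by rewrite exprn_ge0 // invr_ge0.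
  by have := mulr_ge0 w0 f0; lra.
rewrite mulrBl mul1r; lra.
Qed.

Lemma geometric_ok_refine n x : geometric_ok (refine s n x).
Proof.
by elim: n x => [//|n ih] x z; apply: geometric_ok_bind => //; exact: ih.
Qed.

Lemma expect_mlmc p j0 xp (h : V -> \bar R) :
  (expect O (mlmc p j0 s xp) h =
  \int[approx_law O (s, s, xp)]_x
    \sum_(0 <= k <oo) ((1 - p) * p ^+ k)%:E *
      expect O (refine s (j0 + k)%N x) (fun l => h (mlmc_value p j0 k l)))%E.
Proof.
rewrite /mlmc expect_bind; apply: eq_integral => x _.
rewrite expect_bind; congr (limn _); apply/funext => n; apply: eq_bigr => k _.
by congr (_ * _)%E; rewrite expect_bind.
Qed.

(** The base point is reached after [j0.+1] calls, the first of which starts from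
    [s] and [xp]; each of them contributes a factor [1/8]. *)
Lemma mlmc_upper j0 xp (h : V -> \bar R) M a u b : X xp -> 0 <= b ->
  (forall x, ((- M)%:E <= h x <= M%:E)%E) ->
  (forall x, (h x <= (a + dot u (x - y) + b * dot (x - y) (x - y))%:E)%E) ->
  (expect O (mlmc 2^-1 j0 s xp) h <=
   (a + b * (24 / lam) * 8^-1 ^+ j0 *
     (8^-1 * (lam * bregman_e y s + bregman F gradF y xp)))%:E)%E.
Proof.
move=> Xxp b0 hM hh; have half : 0 <= (2^-1 : R) < 1 by lra.
have [K H] := estimator_sums_bounded b0 hh.
have D0 : 0 <= b * (24 / lam) by rewrite mulr_ge0 // divr_ge0 // ltW.
have [G [bG QG sG]] := refine_prefix j0 D0 H.
have D1 : 0 <= b * (24 / lam) * 8^-1 ^+ j0.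
  by rewrite mulr_ge0 // exprn_ge0 // invr_ge0.
have M0 : 0 <= M.
  by have /andP[h1 h2] := hM 0; have := le_trans h1 h2; rewrite lee_fin; lra.
rewrite expect_mlmc.
apply: (approx_integral_le pb aspec Xs Xs Xxp D1) => x Xx; rewrite -/y.
apply: le_trans (_ : _ <= (a + b * (24 / lam) * 8^-1 ^+ j0 * e x)%:E)%E _; last first.
  by rewrite lee_fin lerD2l ler_wpM2l //; exact: (prox_gap_le pb s Xx).
apply: (geometric_sum_le (M := M) (K := K) half) => [k|n].
  apply: expect_bounded => //; first exact: geometric_ok_refine.
apply: le_trans (@geometric_partial_le _ 2^-1 _ (fun k => (G k x)%:E) n.+1 half _) _.
  move=> k; apply: le_trans (QG k x Xx).
  rewrite le_eqVlt; apply/orP; left; apply/eqP; congr expect; apply/funext => l.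
  by rewrite mlmc_value_drop.
by rewrite geometric_partial_fin lee_fin; exact: sG.
Qed.

End MLMC.

(** * RECAPP and its restarts *)

Section Recapp.
Context {R : realType} {d : nat}.
Local Notation V := 'rV[R]_d.
Variables (X : set V) (F : V -> R) (gradF : V -> V) (gam lam : R).
Hypothesis pb : prox_setting X F gradF gam lam.
Variable O : oracles R d.
Hypothesis aspec : approx_prox_spec X F gradF lam O.
Implicit Types (x y z u s v w : V).

Let mX := domain_borel pb.
Let lam0 : 0 < lam := lam_gt0 pb.

(** The only property of UnbiasedProx that the analysis of RECAPP uses.  The
    rest of the program is bounded because [F] is bounded on the domain. *)
Definition implements_unbiased (impl : V -> V -> prog R V V) : Prop :=
  (forall s xp, geometric_ok (impl s xp)) /\
  forall s xp (y := prox X F lam s) (h : V -> \bar R) M a u b,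
  X s -> X xp -> 0 <= b ->
  (forall x, ((- M)%:E <= h x <= M%:E)%E) ->
  (forall x, (h x <= (a + dot u (x - y) + b * dot (x - y) (x - y))%:E)%E) ->
  (expect O (impl s xp) h <=
   (a + b * ((4 * lam)^-1 * (lam * bregman_e y s + bregman F gradF y xp)))%:E)%E.

Lemma oracle_implements_unbiased : unbiased_prox_spec X F gradF lam O ->
  implements_unbiased (fun s xp => UnbiasedProx s xp Ret).
Proof.
move=> us; split=> // s xp y h M a u b Xs Xxp b0 _ hh.
exact: (unbiased_integral_le us Xs Xxp b0 hh).
Qed.

Lemma geometric_ok_mlmc j0 s xp : geometric_ok (mlmc 2^-1 j0 s xp : prog R V V).
Proof.
have half : 0 <= (2^-1 : R) < 1 by lra.
rewrite /mlmc /approx_prox /= => x; split=> // k.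
by apply: geometric_ok_bind => //; exact: geometric_ok_refine.
Qed.

(** With [j0 = 2] the variance factor of MLMC is [24 / 8^3 = 3/64 <= 1/4]. *)
Lemma mlmc_implements_unbiased : implements_unbiased (mlmc 2^-1 2).
Proof.
split=> [s xp|s xp y h M a u b Xs Xxp b0 hM hh]; first exact: geometric_ok_mlmc.
apply: le_trans (mlmc_upper pb aspec Xs 2 Xxp b0 hM hh) _; rewrite -/y lee_fin.
set g := lam * _ + _.
have g0 : 0 <= g.
  apply: addr_ge0; last exact: (bregman_ge0 pb (prox_in pb s) Xxp).
  by apply: mulr_ge0; [exact: ltW|rewrite /bregman_e mulr_ge0 ?sqr_ge0 ?invr_ge0].
have -> : b * (24 / lam) * 8^-1 ^+ 2 * (8^-1 * g) = 3 / 16 * (b * ((4 * lam)^-1 * g)).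
  by field; rewrite lt0r_neq0.
have : 0 <= b * ((4 * lam)^-1 * g).
  by rewrite mulr_ge0 // mulr_ge0 // invr_ge0 mulr_ge0 // ltW.
lra.
Qed.

Variable alpha : nat -> R.
Hypothesis sa : is_step_sequence alpha.
Variable impl : V -> V -> prog R V V.
Hypothesis hi : implements_unbiased impl.

Local Notation run n t x v := (implement_unbiased impl (recapp_iter X alpha n t x v)).
Let Xz : X (argmin X F) := (argmin_min pb).1.
Let zmin x : X x -> F (argmin X F) <= F x := (argmin_min pb).2 x.
Let Fz := F (argmin X F).

Let proj y := Proj_prop (domain_nonempty pb) (domain_compact pb)
  (domain_convex pb) y.

Lemma geometric_ok_recapp_iter n t x v : geometric_ok (recapp_iter X alpha n t x v).
Proof. by elim: n t x v => //= n ih t x v y z; exact: ih. Qed.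

Lemma geometric_ok_epochs T K x : geometric_ok (epochs X alpha T K x).
Proof.
elim: K x => //= K ih x; apply: geometric_ok_bind => //.
exact: geometric_ok_recapp_iter.
Qed.

Let geometric_ok_run n t x v : geometric_ok (run n t x v).
Proof. exact: (geometric_ok_implement hi.1 (geometric_ok_recapp_iter _ _ _ _)). Qed.

Let step_in x v t : X x -> X v ->
  X ((1 - alpha t.+1) *: x + alpha t.+1 *: v).
Proof.
move=> Xx Xv; have [a0 a1 _] := step_bounds sa t.
by rewrite addrC; apply: convex_in => //; [exact: domain_convex pb|lra].
Qed.

Lemma expect_iterS n t x v (k : V -> \bar R)
    (s := (1 - alpha t.+1) *: x + alpha t.+1 *: v) :
  expect O (run n.+1 t x v) k =
  (\int[approx_law O (s, s, x)]_x' expect O (impl s x) (fun xt =>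
     expect O (run n t.+1 x' (Proj X (v - (alpha t.+1)^-1 *: (s - xt)))) k))%E.
Proof. by rewrite /=; apply: eq_integral => x' _; rewrite expect_bind. Qed.

(** The potential decreases in expectation, read backwards: a bound on the final
    value that is affine in the final suboptimality becomes a bound in terms of
    the potential at any earlier iteration. *)
Lemma recapp_iter_upper n t x v (k : V -> \bar R) M c b (z := argmin X F) :
  X x -> X v -> 0 <= b -> (forall x, ((- M)%:E <= k x <= M%:E)%E) ->
  (forall x, X x -> (k x <= (c + b * (F x - Fz))%:E)%E) ->
  (expect O (run n t x v) k <=
   (c + b * alpha (t + n) ^+ 2 *
     ((alpha t)^-1 ^+ 2 * (F x - Fz) + lam / 2 * dot (v - z) (v - z)))%:E)%E.
Proof.
move=> + + b0 kM kb; have M0 : 0 <= M.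
  by have /andP[h1 h2] := kM 0; have := le_trans h1 h2; rewrite lee_fin; lra.
elim: n t x v => [|n ih] t x v Xx Xv.
  rewrite addn0 /=; apply: le_trans (kb x Xx) _; rewrite lee_fin lerD2l.
  have [_ a0] := step_inv_ge sa t.
  have aa : alpha t ^+ 2 * (alpha t)^-1 ^+ 2 = 1.
    by rewrite -exprMn mulfV ?expr1n // lt0r_neq0.
  rewrite -mulrA ler_wpM2l // mulrDr mulrA aa mul1r lerDl.
  by rewrite mulr_ge0 ?sqr_ge0 // mulr_ge0 ?dot_ge0 // divr_ge0 // ltW.
rewrite addnS -addSn expect_iterS.
have Xs := step_in t Xx Xv; set s := _ + _ in Xs *.
set y := prox X F lam s.
have [a0 a58 aS] := step_bounds sa t; set B := (alpha t.+1)^-1 in aS *.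
set C := b * alpha (t.+1 + n) ^+ 2.
have C0 : 0 <= C by rewrite mulr_ge0 ?sqr_ge0.
set w := v - B *: (s - y) - z.
set g := lam * bregman_e y s + bregman F gradF y x.
set W := lam / 2 * (dot w w + B ^+ 2 * ((4 * lam)^-1 * g)).
have inner x' : X x' -> (expect O (impl s x) (fun xt =>
     expect O (run n t.+1 x' (Proj X (v - B *: (s - xt)))) k) <=
     (c + C * (B ^+ 2 * (F x' - Fz) + W))%:E)%E.
  move=> Xx'.
  have := hi.2 s x (fun xt => expect O (run n t.+1 x' (Proj X (v - B *: (s - xt)))) k)
    M (c + C * (B ^+ 2 * (F x' - Fz) + lam / 2 * dot w w)) ((C * lam * B) *: w)
    (C * (lam / 2) * B ^+ 2) Xs Xx.
  rewrite -/y -/g => H; apply: (le_trans (H _ _ _)).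
  - by rewrite mulr_ge0 ?sqr_ge0 // mulr_ge0 // divr_ge0 // ltW.
  - by move=> xt; apply: expect_bounded.
  - move=> xt; apply: (le_trans (ih _ _ _ Xx' (proj _).1)); rewrite lee_fin -/C -/B.
    have := (proj (v - B *: (s - xt))).2 z Xz.
    rewrite !enormE; set p := Proj _ _.
    have -> : v - B *: (s - xt) - z = w + B *: (xt - y).
      by apply/rowP => i; rewrite !mxE; ring.
    rewrite dot_sqrD dotZl => hp.
    have l2 : 0 <= C * (lam / 2) by rewrite mulr_ge0 // divr_ge0 // ltW.
    by have := ler_wpM2l l2 hp; lra.
  - by rewrite lee_fin /W; lra.
apply: le_trans (approx_integral_le pb aspec Xs Xs Xx (b := C * B ^+ 2 * 2)
  (a := c + C * (B ^+ 2 * (F y + lam / 4 * dot (s - y) (s - y) - Fz) + W)) _ _) _.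
- by apply: mulr_ge0 => //; apply: mulr_ge0 => //; exact: sqr_ge0.
- move=> x' Xx'; apply: le_trans (inner x' Xx') _; rewrite lee_fin -/y.
  have CB : 0 <= C * B ^+ 2 by rewrite mulr_ge0 ?sqr_ge0.
  by have := ler_wpM2l CB (value_le_regularized pb s Xx'); rewrite -/y; lra.
rewrite -/y -/g lee_fin.
have := recapp_potential_step pb Xx Xv Xz a0 a58.
rewrite -/s -/y -/g -/B -/Fz -/z -/w -/W aS => /(ler_wpM2l C0); lra.
Qed.

Lemma recapp_upper T (k : V -> \bar R) M c b th x :
  X x -> 0 <= b -> alpha T ^+ 2 * (1 + lam / gam) <= th ->
  (forall x, ((- M)%:E <= k x <= M%:E)%E) ->
  (forall x, X x -> (k x <= (c + b * (F x - Fz))%:E)%E) ->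
  (expect O (implement_unbiased impl (recapp X alpha T x)) k <=
   (c + b * th * (F x - Fz))%:E)%E.
Proof.
move=> Xx b0 hth kM kb.
apply: le_trans (recapp_iter_upper T 0 Xx Xx b0 kM kb) _; rewrite lee_fin add0n.
have gam0 := modulus_gt0 pb; have [a1 _] := sa; rewrite a1 invr1 expr1n mul1r.
have := argmin_growth pb Xx; set z := argmin X F; rewrite -/Fz => hg.
have f0 : 0 <= F x - Fz by rewrite subr_ge0 zmin.
have lg : lam / 2 * dot (x - z) (x - z) <= lam / gam * (F x - Fz).
  have -> : lam / 2 * dot (x - z) (x - z) = lam / gam * (gam / 2 * dot (x - z) (x - z)).
    by field; rewrite lt0r_neq0.
  by rewrite ler_wpM2l // divr_ge0 // ltW.
have A0 : 0 <= b * alpha T ^+ 2 by rewrite mulr_ge0 ?sqr_ge0.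
have h1 := ler_wpM2l A0 lg.
have h2 := ler_wpM2r f0 (ler_wpM2l b0 hth).
lra.
Qed.

(** Each epoch multiplies the expected suboptimality by at most [th]. *)
Lemma epochs_upper T K (k : V -> \bar R) M c b th x :
  X x -> 0 <= b -> 0 <= th -> alpha T ^+ 2 * (1 + lam / gam) <= th ->
  (forall x, ((- M)%:E <= k x <= M%:E)%E) ->
  (forall x, X x -> (k x <= (c + b * (F x - Fz))%:E)%E) ->
  (expect O (implement_unbiased impl (epochs X alpha T K x)) k <=
   (c + b * th ^+ K * (F x - Fz))%:E)%E.
Proof.
move=> + b0 th0 hth kM kb; have M0 : 0 <= M.
  by have /andP[h1 h2] := kM 0; have := le_trans h1 h2; rewrite lee_fin; lra.
elim: K x => [|K ih] x Xx; first by rewrite expr0 mulr1; exact: kb.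
rewrite [epochs _ _ _ _ _]/= implement_bind expect_bind exprSr mulrA.
apply: (recapp_upper (M := M) Xx _ hth).
- by rewrite mulr_ge0 // exprn_ge0.
- move=> x'; apply: expect_bounded => //.
  exact: (geometric_ok_implement hi.1 (geometric_ok_epochs _ _ _)).
- by move=> x' Xx'; exact: ih.
Qed.

(** All points that the algorithm passes to ApproxProx lie in the domain, so its
    answers do too. *)
Lemma recapp_iter_cst n t x v (k : V -> \bar R) c : X x -> X v ->
  (forall x, X x -> k x = c%:E) -> expect O (run n t x v) k = c%:E.
Proof.
move=> + + kc; elim: n t x v => [|n ih] t x v Xx Xv; first exact: kc.
rewrite expect_iterS; have Xs := step_in t Xx Xv; set s := _ + _ in Xs *.
apply: (integral_concentrated_cst mX (prob_kernel _) (aspec Xs Xs Xx).1) => x' Xx'.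
rewrite -[RHS](expect_cst O c (hi.1 s x)); congr expect; apply/funext => xt.
by rewrite ih //; exact: (proj _).1.
Qed.

Lemma epochs_cst T K x (k : V -> \bar R) c : X x ->
  (forall x, X x -> k x = c%:E) ->
  expect O (implement_unbiased impl (epochs X alpha T K x)) k = c%:E.
Proof.
move=> + kc; elim: K x => [|K ih] x Xx; first exact: kc.
rewrite [epochs _ _ _ _ _]/= implement_bind expect_bind.
by apply: recapp_iter_cst => // x' Xx'; exact: ih.
Qed.

Lemma restarted_recapp_correct T K r2 th :
  warm_start_spec X F lam O r2 -> 0 <= th ->
  alpha T ^+ 2 * (1 + lam / gam) <= th ->
  let q := implement_unbiased impl (restarted_recapp X alpha r2 T K) in
  expect O q (fun x => (\1_X x)%:E) = 1%E /\
  (expect O q (fun x => ((F \_ X) x)%:E) - (F (argmin X F))%:E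
    <= (th ^+ K * (lam * r2))%:E)%E.
Proof.
move=> ws th0 hth q; split.
  have wT : warm_law O r2 setT = 1%E by rewrite probability_setT.
  apply: (integral_concentrated_cst mX wT ws.1) => x Xx.
  by apply: epochs_cst => // x' Xx'; rewrite indicE mem_set.
have [M hM] := (bmeas_objective pb).2.
have M0 : 0 <= M := le_trans (normr_ge0 _) (hM _ Xz).
rewrite leeBlDr // -EFinD addrC.
apply: (warm_integral_le pb ws); first by rewrite exprn_ge0.
move=> x Xx; rewrite -/Fz -[th ^+ K]mul1r.
apply: (@epochs_upper T K _ M) => //.
- move=> x'; rewrite patchE !lee_fin; case: ifP => [/set_mem /hM|_].
    by rewrite ler_norml.
  by rewrite oppr_le0 M0.
- by move=> x' Xx'; rewrite patchE mem_set // lee_fin /Fz; lra.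
Qed.

Lemma cost_le_recapp_iter m n t x v : 0 <= m ->
  (forall s xp, cost_le O (impl s xp) m) ->
  cost_le O (run n t x v) (n%:R * (1 + m)).
Proof.
move=> m0 hm; elim: n t x v => [|n ih] t x v.
  by rewrite mul0r; exact: cost_le_Ret.
set s := (1 - alpha t.+1) *: x + alpha t.+1 *: v.
have e : run n.+1 t x v = bind (approx_prox s s x) (fun x' => bind (impl s x)
    (fun xt => run n t.+1 x' (Proj X (v - (alpha t.+1)^-1 *: (s - xt))))) by [].
have n0 : 0 <= n%:R * (1 + m) :> R by rewrite mulr_ge0 // addr_ge0.
rewrite e (_ : _ * _ = 1 + (m + n%:R * (1 + m))); last by rewrite -natr1; ring.
apply: cost_le_bind; [by rewrite addr_ge0|exact: cost_le_approx|move=> x'].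
by apply: cost_le_bind.
Qed.

Lemma cost_le_restarted m r2 T K : 0 <= m ->
  (forall s xp, cost_le O (impl s xp) m) ->
  cost_le O (implement_unbiased impl (restarted_recapp X alpha r2 T K))
    ((T * K)%:R * (1 + m)).
Proof.
move=> m0 hm.
have TK0 n : 0 <= n%:R * (1 + m) :> R by rewrite mulr_ge0 // addr_ge0.
rewrite /restarted_recapp implement_bind -[X in cost_le _ _ X]add0r.
apply: cost_le_bind => //; first exact: cost_le_warm.
elim: K => [|K ih] x /=; first by rewrite muln0 mul0r; exact: cost_le_Ret.
rewrite implement_bind mulnS natrD mulrDl.
by apply: cost_le_bind => //; exact: cost_le_recapp_iter.
Qed.

End Recapp.

(** * Numbers of calls *)

Section Counting.
Context {R : realType} {d : nat}.
Local Notation V := 'rV[R]_d.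
Implicit Types (X : set V) (alpha : nat -> R).

Lemma cost_le_refine (O : oracles R d) (s : V) n x : cost_le O (refine s n x) n%:R.
Proof.
elim: n x => [|n ih] x; first exact: cost_le_Ret.
have -> : refine s n.+1 x = bind (approx_prox s x x)
    (fun x' => bind (refine s n x') (fun xs => Ret (x :: xs))) by [].
rewrite -natr1 addrC; apply: cost_le_bind => //; first exact: cost_le_approx.
move=> x'; rewrite -[n%:R]addr0; apply: cost_le_bind => // xs.
exact: cost_le_Ret.
Qed.

(** One initial call, [j0] deterministic refinements and one more on average. *)
Lemma cost_le_mlmc (O : oracles R d) j0 (s xp : V) :
  cost_le O (mlmc 2^-1 j0 s xp) (j0%:R + 2).
Proof.
rewrite (_ : _ + 2 = 1 + (j0%:R + 1)); last by lra.
apply: cost_le_bind; [by rewrite addr_ge0|exact: cost_le_approx|move=> x].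
apply: cost_le_geometric_half => // k.
rewrite -natrD -[X in cost_le _ _ X]addr0; apply: cost_le_bind => //.
  exact: cost_le_refine.
by move=> xs; exact: cost_le_Ret.
Qed.

Lemma every_output_impl (A : Type) (q : prog R V A) (P Q : A -> Prop) :
  (forall a, P a -> Q a) -> every_output q P -> every_output q Q.
Proof.
by move=> PQ; elim: q => /= [a|s xi xp k ih|s xp k ih|r k ih|p k ih]; auto.
Qed.

Lemma recapp_iter_calls X alpha n t x v a u w :
  every_output (meter_from (Calls a u w) (recapp_iter X alpha n t x v))
    (fun r => r.2 = Calls (a + n) (u + n) w).
Proof.
elim: n t x v a u => [|n ih] t x v a u /=; first by rewrite !addn0.
by move=> x' xt; rewrite !addnS -!addSn; exact: ih.
Qed.

Lemma epochs_calls X alpha T K x a u w :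
  every_output (meter_from (Calls a u w) (epochs X alpha T K x))
    (fun r => r.2 = Calls (a + T * K) (u + T * K) w).
Proof.
elim: K x a u => [|K ih] x a u /=; first by rewrite muln0 !addn0.
rewrite meter_from_bind; apply/every_output_bind.
apply: every_output_impl (recapp_iter_calls X alpha T 0 x x a u w) => -[x' c] /= ->.
by rewrite mulnS !addnA; exact: ih.
Qed.

Lemma restarted_recapp_calls X alpha r2 T K :
  every_output (meter (restarted_recapp X alpha r2 T K))
    (fun r => r.2 = Calls (T * K) (T * K) 1).
Proof. by move=> x; exact: epochs_calls. Qed.

End Counting.

(** * Choice of the parameters *)

Lemma expRN1_ge (R : realType) : 4^-1 <= expR (- 1) :> R.
Proof.
have h : 2^-1 <= expR (- 2^-1) :> R.
  by apply: le_trans (expR_ge1Dx (- 2^-1)); lra.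
have -> : (- 1 : R) = - 2^-1 + - 2^-1 by lra.
by rewrite expRD; nra.
Qed.

(** With [q = sqrt kap] and [T > 6 q] the step satisfies [a (1 + 3 q) <= 1], hence
    [a^2 (1 + q^2) <= 1/4 <= 1/e]. *)
Lemma iteration_number (R : realType) (kap : R) : 1 <= kap ->
  exists2 T : nat, T%:R <= 7 * Num.sqrt kap & forall alpha, is_step_sequence alpha ->
    alpha T ^+ 2 * (1 + kap) <= expR (- 1).
Proof.
move=> k1; set q := Num.sqrt kap.
have q2 : q ^+ 2 = kap by rewrite sqr_sqrtr //; lra.
have q1 : 1 <= q by rewrite -sqrtr1 /q ler_wsqrtr.
have [t1 t2] : (Num.truncn (6 * q))%:R <= 6 * q /\ 6 * q < (Num.truncn (6 * q)).+1%:R.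
  by apply/andP; apply: Num.Theory.truncn_itv; lra.
exists (Num.truncn (6 * q)).+1; first by rewrite -natr1; lra.
move=> alpha sa; have [h a0] := step_inv_ge sa (Num.truncn (6 * q)).+1.
set a := alpha _ in h a0 *; apply: le_trans (expRN1_ge R).
have aa : a * a^-1 = 1 by rewrite mulfV // lt0r_neq0.
have h3 : a * (1 + 3 * q) <= 1.
  by rewrite -[leRHS]aa; apply: ler_wpM2l; [exact: ltW|lra].
have h4 : 0 <= a * (1 + 3 * q) by rewrite mulr_ge0 ?ltW //; lra.
have h5 : (a * (1 + 3 * q)) ^+ 2 <= 1 by rewrite expr_le1.
have h6 : 0 <= a ^+ 2 * (1 + 6 * q + 5 * q ^+ 2 - 4).
  by rewrite mulr_ge0 ?sqr_ge0 //; nra.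
rewrite -q2; lra.
Qed.

Lemma epoch_number (R : realType) (q : R) : 0 < q ->
  exists2 K : nat, K%:R <= 2 * Num.max 1 (ln q) & expR (- 1) ^+ K * q <= 1.
Proof.
move=> q0; set m := Num.max 1 (ln q).
have m1 : 1 <= m by rewrite /m le_max lexx.
have mq : ln q <= m by rewrite /m le_max lexx orbT.
have [t1 t2] : (Num.truncn m)%:R <= m /\ m < (Num.truncn m).+1%:R.
  by apply/andP; apply: Num.Theory.truncn_itv; lra.
exists (Num.truncn m).+1; first by rewrite -natr1; lra.
rewrite -expRM_natl -{1}(lnK q0) -expRD -[leRHS]expR0 ler_expR; lra.
Qed.

Theorem proposition2 (R : realType) :
  exists C : R, 0 < C /\
  forall (d : nat) (X : set 'rV[R]_d) (rad : R)
         (F : 'rV[R]_d -> R) (gradF : 'rV[R]_d -> 'rV[R]_d)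
         (gam lam eps : R),
    X !=set0 -> closed X -> convex_set X -> 0 < rad -> diameter_le X rad ->
    is_gradient_on X F gradF ->
    0 < gam -> strongly_convex_on X F gradF gam ->
    gam <= lam -> 0 < eps ->
  let bound := C * Num.sqrt (lam / gam)
                 * Num.max 1 (ln (lam * rad ^+ 2 / eps)) in
  exists T K : nat,
  forall (alpha : nat -> R) (O : oracles R d),
    is_step_sequence alpha ->
    approx_prox_spec X F gradF lam O ->
    warm_start_spec X F lam O (rad ^+ 2) ->
  let finds_eps_minimizer (q : prog R 'rV[R]_d 'rV[R]_d) :=
    expect O q (fun x => (\1_X x)%:E) = 1%E /\
    (expect O q (fun x => ((F \_ X) x)%:E) - (F (argmin X F))%:E <= eps%:E)%E in
  let alg := restarted_recapp X alpha (rad ^+ 2) T K in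
  let alg_mlmc := implement_unbiased (mlmc 2^-1 2) alg in
  (unbiased_prox_spec X F gradF lam O ->
    finds_eps_minimizer alg /\
    every_output (meter alg) (fun r =>
      n_warm r.2 = 1%N /\
      (n_approx r.2)%:R <= bound /\ (n_unbiased r.2)%:R <= bound)) /\
  (finds_eps_minimizer alg_mlmc /\
   (expect O (meter alg_mlmc) (fun r => ((n_approx r.2)%:R)%:E) <= bound%:E)%E).
Proof.
exists 70; split=> // d X rad F gradF gam lam eps X0 cX vX r0 dX gF g0 scF gl e0 bound.
have pb : prox_setting X F gradF gam lam.
  by split=> //; exact: closed_diameter_compact cX dX.
have l0 : 0 < lam := lam_gt0 pb.
have kap1 : 1 <= lam / gam by rewrite ler_pdivlMr ?mul1r.
set q := lam * rad ^+ 2 / eps in bound *.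
have q0 : 0 < q by rewrite divr_gt0 // mulr_gt0 // exprn_gt0.
have [T Tle hT] := iteration_number kap1.
have [K Kle hK] := epoch_number q0.
have TK : (T * K)%:R * 5 <= bound.
  rewrite natrM /bound; set u := Num.sqrt _ in Tle *; set m := Num.max _ _ in Kle *.
  have := ler_pM (ler0n R T) (ler0n R K) Tle Kle; lra.
have TK1 : (T * K)%:R <= bound by apply: le_trans TK; rewrite ler_peMr //; lra.
exists T, K => alpha O sa aspec ws finds alg alg_mlmc.
have eps_le : expR (- 1) ^+ K * (lam * rad ^+ 2) <= eps.
  have -> : lam * rad ^+ 2 = q * eps by rewrite /q divfK // lt0r_neq0.
  by rewrite mulrA -[leRHS]mul1r ler_wpM2r // ltW.
have finds_impl impl : implements_unbiased X F gradF lam O impl ->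
    finds (implement_unbiased impl alg).
  move=> hi; have [p1 p2] := restarted_recapp_correct pb aspec sa hi K ws
    (expR_ge0 _) (hT _ sa).
  by split=> //; apply: le_trans p2 _; rewrite lee_fin.
split=> [uspec|].
  split.
    rewrite -[alg]implement_unbiased_prox_id; apply: finds_impl.
    exact: oracle_implements_unbiased uspec.
  apply: every_output_impl (restarted_recapp_calls X alpha (rad ^+ 2) T K).
  by move=> r ->.
split; first by apply: finds_impl; exact: (mlmc_implements_unbiased pb aspec).
have [_ /(_ (Calls 0 0 0) 0 (lexx 0))] := cost_le_restarted X alpha (rad ^+ 2) T K
  (addr_ge0 (ler0n R 2) (ler0n R 2)) (cost_le_mlmc O 2).
under eq_fun do rewrite addr0.
by move=> h; apply: le_trans h _; rewrite lee_fin /=; move: TK; lra.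
Qed.
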